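(* The first-order theory of the variety $\mathsf{MV}_\Delta$ of MV$_\Delta$-algebras has a model completion.
   Context: An MV-algebra is an algebra $\langle M,\oplus,\neg,0\rangle$ satisfying $x\oplus(y\oplus z)\approx(x\oplus y)\oplus z$, $x\oplus y\approx y\oplus x$, $x\oplus0\approx x$, $\neg\neg x\approx x$, $x\oplus\neg0\approx\neg0$, $\neg(\neg x\oplus y)\oplus y\approx\neg(\neg y\oplus x)\oplus x$; it carries the lattice order given by $x\vee y:=\neg(\neg x\oplus y)\oplus y$, $x\wedge y:=\neg(\neg x\oplus\neg(\neg x\oplus y))$, with top $1:=\neg0$. $\mathsf{MV}_\Delta$ is the variety, in the language $\{\oplus,\neg,0,\Delta\}$, generated by the linearly ordered MV-algebras expanded with the unary operation $\Delta x:=1$ if $x=1$ and $\Delta x:=0$ otherwise. A model completion of a theory $T$ is a model complete theory with the same universal consequences as $T$ such that for every model $M$ of $T$, it together with the diagram of $M$ is complete. *)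

(* Defs.v *)
(* A small, self-contained development of first-order logic
   in the signature {oplus, neg, 0, Delta} of MV_Delta-algebras, extended by
   a type C of new constant symbols (needed for diagrams). *)

(** Terms over constant symbols C, variables are de Bruijn indices. *)
Inductive term (C : Type) : Type :=
| TVar : nat -> term C
| TCst : C -> term C
| TZero : term C
| TOplus : term C -> term C -> term C
| TNeg : term C -> term C
| TDelta : term C -> term C.
Arguments TVar {C}. Arguments TCst {C}. Arguments TZero {C}.
Arguments TOplus {C}. Arguments TNeg {C}. Arguments TDelta {C}.

Inductive formula (C : Type) : Type :=
| FFalse : formula C
| FEq : term C -> term C -> formula C
| FNot : formula C -> formula C
| FAnd : formula C -> formula C -> formula C
| FOr : formula C -> formula C -> formula C
| FImp : formula C -> formula C -> formula C
| FAll : formula C -> formula C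
| FEx : formula C -> formula C.
Arguments FFalse {C}. Arguments FEq {C}. Arguments FNot {C}.
Arguments FAnd {C}. Arguments FOr {C}. Arguments FImp {C}.
Arguments FAll {C}. Arguments FEx {C}.

Record Structure (C : Type) : Type := {
  carrier :> Type;
  s_oplus : carrier -> carrier -> carrier;
  s_neg : carrier -> carrier;
  s_zero : carrier;
  s_delta : carrier -> carrier;
  s_const : C -> carrier }.
Arguments carrier {C}. Arguments s_oplus {C}. Arguments s_neg {C}.
Arguments s_zero {C}. Arguments s_delta {C}. Arguments s_const {C}.

Definition scons {A : Type} (a : A) (e : nat -> A) : nat -> A :=
  fun n => match n with 0 => a | S k => e k end.

Fixpoint eval {C} (S : Structure C) (e : nat -> S) (t : term C) : S :=
  match t with
  | TVar n => e n
  | TCst c => s_const S c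
  | TZero => s_zero S
  | TOplus t1 t2 => s_oplus S (eval S e t1) (eval S e t2)
  | TNeg t1 => s_neg S (eval S e t1)
  | TDelta t1 => s_delta S (eval S e t1)
  end.

Fixpoint sat {C} (S : Structure C) (e : nat -> S) (phi : formula C) : Prop :=
  match phi with
  | FFalse => False
  | FEq t1 t2 => eval S e t1 = eval S e t2
  | FNot p => ~ sat S e p
  | FAnd p q => sat S e p /\ sat S e q
  | FOr p q => sat S e p \/ sat S e q
  | FImp p q => sat S e p -> sat S e q
  | FAll p => forall a : S, sat S (scons a e) p
  | FEx p => exists a : S, sat S (scons a e) p
  end.

Fixpoint term_closed_at {C} (n : nat) (t : term C) : Prop :=
  match t with
  | TVar k => k < n
  | TCst _ | TZero => True
  | TOplus t1 t2 => term_closed_at n t1 /\ term_closed_at n t2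
  | TNeg t1 | TDelta t1 => term_closed_at n t1
  end.

Fixpoint closed_at {C} (n : nat) (phi : formula C) : Prop :=
  match phi with
  | FFalse => True
  | FEq t1 t2 => term_closed_at n t1 /\ term_closed_at n t2
  | FNot p => closed_at n p
  | FAnd p q | FOr p q | FImp p q => closed_at n p /\ closed_at n q
  | FAll p | FEx p => closed_at (S n) p
  end.

Definition sentence {C} (phi : formula C) : Prop := closed_at 0 phi.

Fixpoint qfree {C} (phi : formula C) : Prop :=
  match phi with
  | FFalse | FEq _ _ => True
  | FNot p => qfree p
  | FAnd p q | FOr p q | FImp p q => qfree p /\ qfree q
  | FAll _ | FEx _ => False
  end.

Inductive universal {C} : formula C -> Prop :=
| univ_qf : forall phi, qfree phi -> universal phi
| univ_all : forall phi, universal phi -> universal (FAll phi).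

Definition theory (C : Type) := formula C -> Prop.

Definition is_model {C} (T : theory C) (S : Structure C) : Prop :=
  forall phi, T phi -> forall e : nat -> S, sat S e phi.

Definition entails {C} (T : theory C) (phi : formula C) : Prop :=
  forall S : Structure C, is_model T S -> forall e : nat -> S, sat S e phi.

Definition complete {C} (T : theory C) : Prop :=
  (exists S : Structure C, is_model T S) /\
  forall phi, sentence phi -> entails T phi \/ entails T (FNot phi).

Definition L0 := Empty_set.

Definition embedding (M N : Structure L0) (f : M -> N) : Prop :=
  (forall x y, f x = f y -> x = y) /\
  (forall x y, f (s_oplus M x y) = s_oplus N (f x) (f y)) /\
  (forall x, f (s_neg M x) = s_neg N (f x)) /\
  f (s_zero M) = s_zero N /\
  (forall x, f (s_delta M x) = s_delta N (f x)).

Definition elementary (M N : Structure L0) (f : M -> N) : Prop :=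
  forall (phi : formula L0) (e : nat -> M),
    sat M e phi <-> sat N (fun n => f (e n)) phi.

Definition model_complete (T : theory L0) : Prop :=
  forall (M N : Structure L0) (f : M -> N),
    is_model T M -> is_model T N -> embedding M N f -> elementary M N f.

Fixpoint tmap {C D} (g : C -> D) (t : term C) : term D :=
  match t with
  | TVar n => TVar n
  | TCst c => TCst (g c)
  | TZero => TZero
  | TOplus t1 t2 => TOplus (tmap g t1) (tmap g t2)
  | TNeg t1 => TNeg (tmap g t1)
  | TDelta t1 => TDelta (tmap g t1)
  end.

Fixpoint fmap {C D} (g : C -> D) (phi : formula C) : formula D :=
  match phi with
  | FFalse => FFalse
  | FEq t1 t2 => FEq (tmap g t1) (tmap g t2)
  | FNot p => FNot (fmap g p)
  | FAnd p q => FAnd (fmap g p) (fmap g q)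
  | FOr p q => FOr (fmap g p) (fmap g q)
  | FImp p q => FImp (fmap g p) (fmap g q)
  | FAll p => FAll (fmap g p)
  | FEx p => FEx (fmap g p)
  end.

Definition lift {D} (phi : formula L0) : formula D :=
  fmap (fun c : L0 => match c with end) phi.

Definition expand (M : Structure L0) : Structure (carrier M) := {|
  carrier := carrier M;
  s_oplus := s_oplus M; s_neg := s_neg M; s_zero := s_zero M;
  s_delta := s_delta M; s_const := fun a => a |}.

Definition literal {C} (phi : formula C) : Prop :=
  match phi with
  | FEq _ _ => True
  | FNot (FEq _ _) => True
  | _ => False
  end.

Definition diagram (M : Structure L0) : theory (carrier M) :=
  fun phi => sentence phi /\ literal phi /\
             forall e, sat (expand M) e phi.

Definition with_diagram (Ts : theory L0) (M : Structure L0)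
  : theory (carrier M) :=
  fun psi => (exists phi, Ts phi /\ psi = lift phi) \/ diagram M psi.

Definition has_model_completion (T : theory L0) : Prop :=
  exists Ts : theory L0,
    (forall phi, Ts phi -> sentence phi) /\
    model_complete Ts /\
    (forall phi, sentence phi -> universal phi ->
        (entails T phi <-> entails Ts phi)) /\
    (forall M : Structure L0, is_model T M -> complete (with_diagram Ts M)).

Section MV.
Variable A : Structure L0.
Local Notation "x (+) y" := (s_oplus A x y) (at level 50, left associativity).
Local Notation "¬ x" := (s_neg A x) (at level 35, right associativity).
Local Notation "0" := (s_zero A).

Definition mv_one : A := ¬ 0.
Definition mv_join (x y : A) : A := ¬ (¬ x (+) y) (+) y.
Definition mv_le (x y : A) : Prop := mv_join x y = y.

Definition is_MV : Prop :=
  (forall x y z, x (+) (y (+) z) = (x (+) y) (+) z) /\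
  (forall x y, x (+) y = y (+) x) /\
  (forall x, x (+) 0 = x) /\
  (forall x, ¬ ¬ x = x) /\
  (forall x, x (+) ¬ 0 = ¬ 0) /\
  (forall x y, ¬ (¬ x (+) y) (+) y = ¬ (¬ y (+) x) (+) x).

Definition is_MVDelta_chain : Prop :=
  is_MV /\ (forall x y, mv_le x y \/ mv_le y x) /\
  (forall x, (x = mv_one -> s_delta A x = mv_one) /\
             (x <> mv_one -> s_delta A x = 0)).
End MV.

(** Membership in the variety generated by the MV_Delta-chains:
    satisfying every identity valid in all MV_Delta-chains. *)
Definition is_MVDelta (A : Structure L0) : Prop :=
  forall t1 t2 : term L0,
    (forall B : Structure L0, is_MVDelta_chain B ->
       forall e : nat -> B, eval B e t1 = eval B e t2) ->
    forall e : nat -> A, eval A e t1 = eval A e t2.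

Definition Th_MVDelta : theory L0 :=
  fun phi => sentence phi /\
    forall A : Structure L0, is_MVDelta A -> forall e : nat -> A, sat A e phi.

(* Main.v *)
(* The completion is the common theory of the one-element algebra and of the
   algebra A of periodic sequences in the rational interval [0,1].

   Quantifier elimination for A. A quantifier-free formula is a disjunction of
   conditions "theta holds at every index, and each psi_j at some index", where
   theta and psi_j are Boolean combinations of linear inequalities over [0,1].
   Enlarging the period leaves room to realise all psi_j at different indices,
   so an existential quantifier passes to theta and to the theta /\ psi_j, where
   it is eliminated by testing midpoints of critical points (Ferrante-Rackoff).
   A linear inequality is in turn an equation between MV_Delta-terms, since
   truncating an integer affine function to [0,1] gives an MV-term.

   Embedding. The same elimination, read in the Chang group of an arbitrary
   chain, shows that a quantifier-free formula satisfiable in some nontrivial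
   chain is satisfiable in [0,1]. Every chain implication between equations is
   coded by an identity (Delta gives a discriminator), so finitely many equations
   and inequations true in a nontrivial MV_Delta-algebra M are satisfiable in A,
   and M embeds into an ultrapower of A. *)

From HB Require Import structures.
From mathcomp Require Import all_boot all_order all_algebra.
From mathcomp Require Import boolp classical_sets filter.
From mathcomp Require Import zify ring lra.
Require Import Defs.

Set Implicit Arguments.
Unset Strict Implicit.
Unset Printing Implicit Defensive.

(** * First-order logic *)

Section Logic.
Variable C : Type.
Implicit Types (M : Structure C) (t : term C) (p q : formula C).

Lemma eval_ext M (e e' : nat -> M) n t : term_closed_at n t ->
  (forall k, k < n -> e k = e' k) -> eval M e t = eval M e' t.
Proof.
move=> + ee; elim: t => //= [k kn|t IHt s IHs [/IHt -> /IHs ->]|t IH /IH ->|t IH /IH ->] //.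
by apply: ee; apply/ltP.
Qed.

Lemma sat_ext M (e e' : nat -> M) n p : closed_at n p ->
  (forall k, k < n -> e k = e' k) -> sat M e p <-> sat M e' p.
Proof.
elim: p n e e' => //= [t s|p IH|p IHp q IHq|p IHp q IHq|p IHp q IHq|p IH|p IH] n e e'.
- by case=> ct cs ee; rewrite (eval_ext ct ee) (eval_ext cs ee).
- by move=> cp ee; rewrite (IH _ _ _ cp ee).
1,2,3: by case=> cp cq ee; rewrite (IHp _ _ _ cp ee) (IHq _ _ _ cq ee).
all: move=> cp ee; have sat_scons a : sat M (scons a e) p <-> sat M (scons a e') p.
1,3: by apply: (IH n.+1) => // -[|k] //=; apply: ee.
- by split=> H a; apply/sat_scons.
- by split=> -[a /sat_scons H]; exists a.
Qed.

Lemma term_closed_at_mono m n t : m <= n -> term_closed_at m t -> term_closed_at n t.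
Proof. by move=> mn; elim: t => //= [k|t IHt s IHs [/IHt ? /IHs ?]] //; lia. Qed.

Lemma closed_at_mono m n p : m <= n -> closed_at m p -> closed_at n p.
Proof.
elim: p m n => //= [t s|p IHp q IHq|p IHp q IHq|p IHp q IHq|p IH|p IH] m n mn.
- by case=> ? ?; split; apply: (term_closed_at_mono mn).
1,2,3: by case=> ? ?; split; [apply: (IHp m)|apply: (IHq m)].
all: by apply: IH.
Qed.

Lemma term_closed_exists t : exists n, term_closed_at n t.
Proof.
elim: t => [k|c||t [n nt] s [m ms]|t [n nt]|t [n nt]] /=.
1: by exists k.+1; apply/ltP.
1,2: by exists 0.
2,3: by exists n.
by exists (maxn n m); split; [apply: term_closed_at_mono nt|apply: term_closed_at_mono ms]; lia.
Qed.

Lemma closed_exists p : exists n, closed_at n p.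
Proof.
elim: p => [|t s|p [n np]|p [n np] q [m mq]|p [n np] q [m mq]|p [n np] q [m mq]|p [n np]|p [n np]] /=.
- by exists 0.
- have [n nt] := term_closed_exists t; have [m ms] := term_closed_exists s.
  by exists (maxn n m); split; [apply: term_closed_at_mono nt|apply: term_closed_at_mono ms]; lia.
- by exists n.
1,2,3: by exists (maxn n m); split; [apply: closed_at_mono np|apply: closed_at_mono mq]; lia.
all: by exists n; apply: closed_at_mono np.
Qed.

Definition generalize n p := iter n FAll p.

Lemma sentence_generalize n p : closed_at n p -> sentence (generalize n p).
Proof.
rewrite /sentence /generalize -{1}[n]addn0; elim: n 0 => [|n IH] m //= H.
by apply: IH; rewrite addnS.
Qed.

Lemma sat_generalize M e n p : closed_at n p ->
  sat M e (generalize n p) <-> forall e', sat M e' p.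
Proof.
(* The [n] quantifiers prepend [n] arbitrary values to [e], so the environments reached are those
   that agree with [e] after a shift by [n]. *)
move=> np; have unfold : sat M e (generalize n p) <->
    forall e', (forall k, e' (k + n) = e k) -> sat M e' p.
  rewrite /generalize; elim: n e {np} => [|n IH] e /=.
    split=> [H e' ee|H]; last by apply: H => k; rewrite addn0.
    by suff -> : e' = e by []; apply: funext => k; rewrite -(ee k) addn0.
  split=> [H e' ee|H a].
    have /IH := H (e' n); apply=> -[|k] //=; by rewrite addSnnS ee.
  by apply/IH => e' ee; apply: H => k; rewrite addnS -addSn ee.
rewrite unfold; split=> [H e'|H e' _]; last exact: H.
(* Only the first [n] values of [e'] matter, so its tail is replaced by [e]. *)
apply/(sat_ext (e' := fun k => if k < n then e' k else e (k - n)) np) => [k ->//|].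
by apply: H => k; rewrite addnK ltnNge leq_addl.
Qed.

End Logic.

(** * Reducts, and preservation of formulas under embeddings *)

Section Embeddings.
Variable C : Type.

Definition reduct (M : Structure C) : Structure L0 := {|
  carrier := M; s_oplus := s_oplus M; s_neg := s_neg M; s_zero := s_zero M;
  s_delta := s_delta M; s_const := fun c : L0 => match c with end |}.

Lemma sat_lift (M : Structure C) (e : nat -> M) p :
  sat M e (lift p) <-> sat (reduct M) e p.
Proof.
have evalE e' t : eval M e' (tmap (fun c : L0 => match c with end) t) = eval (reduct M) e' t.
  by elim: t => [k|[]||t IHt s IHs|t IH|t IH] //=; rewrite ?IHt ?IHs ?IH.
elim: p e => //= [t s|p IH|p IHp q IHq|p IHp q IHq|p IHp q IHq|p IH|p IH] e.
- by rewrite !evalE.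
- by rewrite IH.
1,2,3: by rewrite IHp IHq.
- by split=> H a; apply/IH.
- by split=> -[a /IH]; exists a.
Qed.

Lemma eval_embedding (M N : Structure L0) f e t : embedding M N f ->
  eval N (fun n => f (e n)) t = f (eval M e t).
Proof.
case=> _ [fD [fN [f0 fd]]].
by elim: t => [k|[]||t IHt s IHs|t IH|t IH] //=; rewrite ?fD ?fN ?fd ?IHt ?IHs ?IH.
Qed.

Lemma sat_embedding (M N : Structure L0) f e p : embedding M N f -> qfree p ->
  sat N (fun n => f (e n)) p <-> sat M e p.
Proof.
move=> emb; elim: p => //= [t s _|p IH|p IHp q IHq|p IHp q IHq|p IHp q IHq].
- by rewrite !(eval_embedding _ _ emb); split=> [|->//]; apply: (proj1 emb).
- by move/IH ->.
all: by case=> /IHp -> /IHq ->.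
Qed.

Lemma universal_embedding (M N : Structure L0) f p : embedding M N f -> universal p ->
  forall e, sat N (fun n => f (e n)) p -> sat M e p.
Proof.
move=> emb; elim=> {p} [p qp|p _ IH] e; first by rewrite (sat_embedding _ emb).
move=> /= H a; apply: IH; have := H (f a).
by rewrite (_ : scons (f a) _ = fun n => f (scons a e n)) //; apply: funext => -[].
Qed.

End Embeddings.

(* Constants named by [g] become free variables; [d] counts the binders crossed. *)
Section Constants.
Variables (C : Type) (g : C -> nat).

Fixpoint tvars_of_consts d (t : term C) : term L0 :=
  match t with
  | TVar k => TVar k
  | TCst c => TVar (d + g c)
  | TZero => TZero
  | TOplus t s => TOplus (tvars_of_consts d t) (tvars_of_consts d s)
  | TNeg t => TNeg (tvars_of_consts d t)
  | TDelta t => TDelta (tvars_of_consts d t)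
  end.

Fixpoint vars_of_consts d (p : formula C) : formula L0 :=
  match p with
  | FFalse => FFalse
  | FEq t s => FEq (tvars_of_consts d t) (tvars_of_consts d s)
  | FNot p => FNot (vars_of_consts d p)
  | FAnd p q => FAnd (vars_of_consts d p) (vars_of_consts d q)
  | FOr p q => FOr (vars_of_consts d p) (vars_of_consts d q)
  | FImp p q => FImp (vars_of_consts d p) (vars_of_consts d q)
  | FAll p => FAll (vars_of_consts d.+1 p)
  | FEx p => FEx (vars_of_consts d.+1 p)
  end.

Fixpoint tconsts (t : term C) : list C :=
  match t with
  | TVar _ | TZero => nil
  | TCst c => c :: nil
  | TOplus t s => tconsts t ++ tconsts s
  | TNeg t | TDelta t => tconsts t
  end.

Fixpoint consts (p : formula C) : list C :=
  match p with
  | FFalse => nil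
  | FEq t s => tconsts t ++ tconsts s
  | FNot p | FAll p | FEx p => consts p
  | FAnd p q | FOr p q | FImp p q => consts p ++ consts q
  end.

Variable h : nat -> C.

(** Inverting [g] on the finitely many constants that occur is enough, which is why a structure of
    any cardinality can be coded by variables. *)
Lemma eval_vars_of_consts (M : Structure C) d (e e' : nat -> M) t :
    term_closed_at d t -> (forall c, List.In c (tconsts t) -> h (g c) = c) ->
    (forall k, k < d -> e' k = e k) -> (forall k, e' (d + k) = s_const M (h k)) ->
  eval M e t = eval (reduct M) e' (tvars_of_consts d t).
Proof.
move=> + + e'e e'h; elim: t => //= [k /ltP kd _|c _ hc|t IHt s IHs [ct cs] hc|t IH ct hc|t IH ct hc].
- by rewrite e'e.
- by rewrite e'h hc //; left.
- rewrite IHt // => [|c ?]; last by apply: hc; apply/List.in_or_app; left.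
  by rewrite IHs // => c ?; apply: hc; apply/List.in_or_app; right.
- by rewrite IH.
- by rewrite IH.
Qed.

Lemma sat_vars_of_consts (M : Structure C) d (e e' : nat -> M) p :
    closed_at d p -> (forall c, List.In c (consts p) -> h (g c) = c) ->
    (forall k, k < d -> e' k = e k) -> (forall k, e' (d + k) = s_const M (h k)) ->
  sat M e p <-> sat (reduct M) e' (vars_of_consts d p).
Proof.
elim: p d e e' => //= [t s|p IH|p IHp q IHq|p IHp q IHq|p IHp q IHq|p IH|p IH] d e e'.
- case=> ct cs hc e'e e'h.
  rewrite -!(@eval_vars_of_consts _ d e e') // => c ?; apply: hc; apply/List.in_or_app; tauto.
- by move=> cp hc e'e e'h; rewrite (IH d e e').
1,2,3: case=> cp cq hc e'e e'h.
1,2,3: by rewrite (IHp d e e') ?(IHq d e e') // => c ?; apply: hc; apply/List.in_or_app; tauto.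
all: move=> cp hc e'e e'h.
all: have E a : sat M (scons a e) p <-> sat (reduct M) (scons a e') (vars_of_consts d.+1 p).
1,3: by apply: IH => // -[|k] //=; apply: e'e.
- by split=> H a; apply/E.
- by split=> -[a /E]; exists a.
Qed.

End Constants.

(** A constant is indexed by a position in the list where it stands; [c0] is the value of [h] beyond
    the end. *)
Lemma indexing_exists C (c0 : C) (s : list C) :
  exists (g : C -> nat) (h : nat -> C), forall c, List.In c s -> h (g c) = c.
Proof.
pose P c n := List.In c s -> List.nth n s c0 = c.
have [|g gP] := choice (P := P).
  move=> c; rewrite /P; case: (pselect (List.In c s)) => [cs|]; last by exists 0.
  by have [n [_ ?]] := List.In_nth _ _ c0 cs; exists n.
by exists g, (fun n => List.nth n s c0).
Qed.

(** * Ultraproducts *)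

Local Open Scope classical_set_scope.

Section Ultraproduct.
Variables (C I : Type) (U : set_system I) (UF : UltraFilter U) (S : I -> Structure C).
Implicit Types f g : forall i, S i.

Definition ueq f g := U [set i | f i = g i].

Lemma ueqP f g : ueq f = ueq g <-> ueq f g.
Proof.
split=> [->|fg]; first by apply: filterS filterT => i.
apply: funext => h; apply: propext; split=> H; apply: filterS (filterI fg H) => i [/= a b].
  by rewrite -a.
by rewrite a.
Qed.

(** An element is an equivalence class modulo [U], given as a predicate, so that equality of
    elements is agreement on a set of [U]. *)
Definition ucarrier := {X : (forall i, S i) -> Prop | exists f, X = ueq f}.
Definition upi f : ucarrier := exist _ (ueq f) (ex_intro _ f erefl).
Definition urepr (a : ucarrier) : forall i, S i := projT1 (cid (proj2_sig a)).

Lemma upiP f g : upi f = upi g <-> U [set i | f i = g i].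
Proof.
rewrite -[U _]/(ueq f g) -ueqP; split=> [[]//|fg].
by apply: eq_exist.
Qed.

Lemma upiK a : upi (urepr a) = a.
Proof.
case: a => X Xf; apply: eq_exist; rewrite /urepr /=.
by case: cid => f /= ->.
Qed.

Lemma urepr_pi f : U [set i | urepr (upi f) i = f i].
Proof. by apply/upiP; rewrite upiK. Qed.

Definition ultraproduct : Structure C := {|
  carrier := ucarrier;
  s_oplus a b := upi (fun i => s_oplus (S i) (urepr a i) (urepr b i));
  s_neg a := upi (fun i => s_neg (S i) (urepr a i));
  s_zero := upi (fun i => s_zero (S i));
  s_delta a := upi (fun i => s_delta (S i) (urepr a i));
  s_const c := upi (fun i => s_const (S i) c) |}.
Local Notation N := ultraproduct.

Lemma upi_oplus f g :
  s_oplus N (upi f) (upi g) = upi (fun i => s_oplus (S i) (f i) (g i)).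
Proof. by apply/upiP; apply: filterS (filterI (urepr_pi f) (urepr_pi g)) => i [/= -> ->]. Qed.

Lemma upi_neg f : s_neg N (upi f) = upi (fun i => s_neg (S i) (f i)).
Proof. by apply/upiP; apply: filterS (urepr_pi f) => i /= ->. Qed.

Lemma upi_delta f : s_delta N (upi f) = upi (fun i => s_delta (S i) (f i)).
Proof. by apply/upiP; apply: filterS (urepr_pi f) => i /= ->. Qed.

Implicit Types e : nat -> forall i, S i.

Lemma eval_ultraproduct e t :
  eval N (fun n => upi (e n)) t = upi (fun i => eval (S i) (fun n => e n i) t).
Proof.
elim: t => // [t IHt s IHs|t IH|t IH].
- by apply: etrans (upi_oplus _ _); rewrite -IHt -IHs.
- by apply: etrans (upi_neg _); rewrite -IH.
- by apply: etrans (upi_delta _); rewrite -IH.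
Qed.

Lemma ultra_not (X : set I) : U (~` X) <-> ~ U X.
Proof.
split=> [nX X'|nX]; last by case: (in_ultra_setVsetC X UF).
by have [i []] := filter_ex (filterI nX X').
Qed.

Lemma upi_scons f e :
  scons (upi f) (fun n => upi (e n)) = fun n => upi (scons f e n).
Proof. by apply: funext => -[]. Qed.

Lemma ultra_scons f e p :
  U [set i | sat (S i) (fun n => scons f e n i) p] =
  U [set i | sat (S i) (scons (f i) (fun n => e n i)) p].
Proof.
congr U; apply/funext => i /=; rewrite (_ : (fun n => _) = scons (f i) (fun n => e n i)) //.
by apply: funext => -[].
Qed.

(** Łoś's theorem. Negation uses the maximality of [U], the quantifiers a choice of one element in
    each factor. *)
Lemma los e p :
  sat N (fun n => upi (e n)) p <-> U [set i | sat (S i) (fun n => e n i) p].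
Proof.
elim: p e => [|t s|p IH|p IHp q IHq|p IHp q IHq|p IHp q IHq|p IH|p IH] e.
- by split=> //= /filter_ex[].
- by rewrite /= !eval_ultraproduct upiP.
- by rewrite /= IH -ultra_not.
- rewrite /= IHp IHq; split=> [[pU qU]|pq]; first exact: filterI.
  by split; apply: filterS pq => i [].
- rewrite /= IHp IHq; split=> [[]|pq]; [by apply: filterS; left|by apply: filterS; right|].
  case: (pselect (U [set i | sat (S i) (fun n => e n i) p])) => [|/ultra_not np]; first by left.
  by right; apply: filterS (filterI np pq) => i [/= a []].
- rewrite /= IHp IHq; split=> [pq|pq pU]; last first.
    by apply: filterS (filterI pq pU) => i [/= a b]; apply: a.
  case: (pselect (U [set i | sat (S i) (fun n => e n i) p])) => [/pq|/ultra_not].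
    by apply: filterS => i Hq _.
  by apply: filterS => i np /np.
- split=> [H|H a]; last first.
    rewrite -(upiK a) upi_scons; apply/IH; rewrite ultra_scons.
    by apply: filterS H => i; apply.
  apply: contrapT => /ultra_not nU.
  (* In each factor [f] picks a counterexample to [p] if there is one; its class would then refute
     the universal formula. *)
  have [f fP] : exists f, forall i, sat (S i) (scons (f i) (fun n => e n i)) p ->
      sat (S i) (fun n => e n i) (FAll p).
    have pick i : exists a, sat (S i) (scons a (fun n => e n i)) p ->
        sat (S i) (fun n => e n i) (FAll p).
      case: (pselect (sat (S i) (fun n => e n i) (FAll p))) => [all_p|].
        by exists (s_zero (S i)).
      by move/existsNP=> [a na]; exists a.
    by exists (fun i => projT1 (cid (pick i))) => i; apply: projT2 (cid (pick i)).
  have := H (upi f); rewrite upi_scons => /IH; rewrite ultra_scons => fU.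
  by have [i [ni /fP]] := filter_ex (filterI nU fU).
- split=> [[a]|H].
    rewrite -(upiK a) upi_scons => /IH; rewrite ultra_scons.
    by apply: filterS => i ?; exists (urepr a i).
  have pick i : exists a, sat (S i) (fun n => e n i) (FEx p) ->
      sat (S i) (scons a (fun n => e n i)) p.
    case: (pselect (sat (S i) (fun n => e n i) (FEx p))) => [[a pa]|]; first by exists a.
    by exists (s_zero (S i)).
  exists (upi (fun i => projT1 (cid (pick i)))); rewrite upi_scons; apply/IH.
  by rewrite ultra_scons; apply: filterS H => i /(projT2 (cid (pick i))).
Qed.

End Ultraproduct.

(** The cones of lists containing a given finite list generate a proper filter, since each list lies
    in its own cone. The ultrafilter serves to glue maps that behave well only on finite lists. *)
Lemma cone_ultrafilter (T : Type) : exists U : set_system (seq T),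
  UltraFilter U /\ forall a, U [set s | List.In a s].
Proof.
pose F : set_system (seq T) :=
  [set X | exists s0, forall s, (forall a, List.In a s0 -> List.In a s) -> X s].
have FF : ProperFilter F.
  split; first by move=> [s0 /(_ s0)]; apply.
  split; first by exists nil.
    move=> X Y [s Xs] [s' Ys']; exists (s ++ s') => r rP.
    by split; [apply: Xs|apply: Ys'] => a ?; apply: rP; apply/List.in_or_app; [left|right].
  by move=> X Y XY [s Xs]; exists s => r rP; apply/XY/Xs.
have [U [UU FU]] := ultraFilterLemma FF; exists U; split=> // a.
by apply: FU; exists [:: a] => s; apply; left.
Qed.

Local Close Scope classical_set_scope.

(** * Linear arithmetic in ordered abelian groups *)

Import Order.TTheory GRing.Theory Num.Theory.
Local Open Scope ring_scope.

(** A linear group order given by its strictly positive elements, so that ordered fields and the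
    Chang group of a chain are treated alike. *)
Record positive_cone (G : zmodType) (pos : G -> Prop) : Prop := {
  posD : forall x y, pos x -> pos y -> pos (x + y);
  pos0 : ~ pos 0;
  pos_total : forall x, [\/ pos x, x = 0 | pos (- x)] }.

Section Cone.
Variables (G : zmodType) (pos : G -> Prop) (cone : positive_cone pos).
Implicit Types (x y : G) (k : int).

Lemma pos_opp x : pos x -> ~ pos (- x).
Proof. by move=> px pnx; apply: (pos0 cone); rewrite -(subrr x); apply: posD. Qed.

Definition nneg x := ~ pos (- x).

Lemma nnegP x : nneg x <-> pos x \/ x = 0.
Proof.
split=> [nx | [/pos_opp // | ->]]; last by rewrite /nneg oppr0; apply: pos0.
by case: (pos_total cone x) => [|->|/nx]; [left | right |].
Qed.

Lemma posD_nneg x y : pos x -> nneg y -> pos (x + y).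
Proof. by move=> px /nnegP[py|->]; [apply: posD | rewrite addr0]. Qed.

Lemma pos_mulrz k x : 0 < k -> pos x -> pos (x *~ k).
Proof.
case: k => [[|n]|n] // _ px; rewrite -pmulrn.
by elim: n => [|n IH]; rewrite ?mulr1n // mulrS; apply: posD.
Qed.

Lemma pos_mulrzE k x : 0 < k -> pos (x *~ k) <-> pos x.
Proof.
move=> k0; split; last exact: pos_mulrz.
case: (pos_total cone x) => [//|->|pn]; rewrite ?mul0rz //.
by have := pos_opp (pos_mulrz k0 pn); rewrite mulNrz opprK.
Qed.

Lemma nneg_mulrzE k x : 0 < k -> nneg (x *~ k) <-> nneg x.
Proof. by move=> k0; rewrite /nneg -mulNrz pos_mulrzE. Qed.

(* The comparison of the fractions v / w, cleared of denominators. *)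
Lemma max_ratio T (s : seq T) (P : T -> Prop) (w : T -> int) (v : T -> G) :
    (forall t, List.In t s -> 0 < w t) -> (exists2 t, List.In t s & P t) ->
  exists t, [/\ List.In t s, P t &
    forall t', List.In t' s -> P t' -> nneg (v t *~ w t' - v t' *~ w t)].
Proof.
move=> + [t0]; elim: s t0 => //= a s IH t0 ws t0s Pt0.
have nneg_refl x k : nneg (x *~ k - x *~ k) by rewrite subrr; apply/nnegP; right.
case: (pselect (exists2 t, List.In t s & P t)) => [[t1 t1s Pt1]|nos]; last first.
  case: t0s => [eat|]; last by move=> t0s; case: nos; exists t0.
  subst t0; exists a; split=> // [|t' [<-//|t's Pt']]; first by left.
  by case: nos; exists t'.
have ws' t : List.In t s -> 0 < w t by move=> ts; apply: ws; right.
have [t [ts Pt tmax]] := IH t1 ws' t1s Pt1.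
case: (pselect (P a /\ pos (v a *~ w t - v t *~ w a))) => [[Pa at0]|nPa].
  exists a; split=> // [|t' [<-//|t's Pt']]; first by left.
  (* Transitivity of the comparison of fractions, through [t]; the factor [w t] makes both
     intermediate differences appear without division. *)
  apply/(nneg_mulrzE _ (ws' _ ts)).
  have -> : (v a *~ w t' - v t' *~ w a) *~ w t =
            (v a *~ w t - v t *~ w a) *~ w t' + (v t *~ w t' - v t' *~ w t) *~ w a.
    rewrite !mulrzBl -!mulrzA addrA [w t * w t']mulrC [w a * w t']mulrC subrK.
    by rewrite [w t * w a]mulrC.
  apply/nnegP; left; apply: posD_nneg; first exact: pos_mulrz (ws' _ t's) _.
  by apply/nneg_mulrzE; [apply: ws; left | apply: tmax].
exists t; split=> // [|t' [<-|t's]]; first by right.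
  by move=> Pa; rewrite /nneg opprB => at0; apply: nPa.
exact: tmax.
Qed.

(* If F = k x + l, A = a x + l_a and B = b x + l_b, where the zeros of A and B
   enclose x with no zero of F strictly between them except possibly x, then [D]
   is 2 a b F evaluated at the midpoint of these zeros. *)
Lemma midpoint_sign (k a b : int) (F A B : G) : 0 < a -> 0 < b ->
    nneg A -> nneg (- B) ->
    (nneg F -> nneg (F *~ a - A *~ k)) -> (nneg (- F) -> nneg (B *~ k - F *~ b)) ->
  let D := (F *~ a - A *~ k) *~ b + (F *~ b - B *~ k) *~ a in
  0 < k -> (pos D <-> pos F) /\ (pos (- D) <-> pos (- F)).
Proof.
move=> a0 b0 A0 B0 FA FB D k0.
have pD : pos F -> pos D.
  move=> pF; rewrite /D addrC; apply: posD_nneg.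
    apply/pos_mulrzE => //; apply: posD_nneg; first exact: pos_mulrz.
    by rewrite -mulNrz; apply/nneg_mulrzE.
  by apply/nneg_mulrzE => //; apply: FA; apply/nnegP; left.
have nD : pos (- F) -> pos (- D).
  move=> pF; rewrite /D opprD -(mulNrz (F *~ a - _)) -(mulNrz (F *~ b - _)) !opprB.
  apply: posD_nneg.
    apply/pos_mulrzE => //; rewrite addrC -mulNrz.
    by apply: posD_nneg; [apply: pos_mulrz | apply/nneg_mulrzE].
  by apply/nneg_mulrzE => //; apply: FB; apply/nnegP; left.
(* If F vanishes at x, both side conditions apply and force A and B to vanish too: both zeros are x
   itself. *)
have zD : F = 0 -> D = 0.
  move=> F0; have: nneg (- A).
    apply/(nneg_mulrzE _ k0); have := FA; rewrite F0 mul0rz sub0r mulNrz; apply.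
    by apply/nnegP; right.
  have: nneg B.
    apply/(nneg_mulrzE _ k0); have := FB; rewrite F0 mul0rz subr0; apply.
    by apply/nnegP; right; rewrite oppr0.
  have z X : nneg X -> nneg (- X) -> X = 0.
    by move=> /nnegP[pX|//] nX; case: nX; rewrite opprK.
  move=> nB nA; rewrite /D F0 (z A) // (z B) //.
  by rewrite ?(mul0rz, subrr, addr0).
split; split=> // p; case: (pos_total cone F) => //.
- by move/zD=> D0; case: (pos0 cone); rewrite -{1}D0.
- by move/nD/(pos_opp p).
- by move/pD/pos_opp/(_ p).
- by move/zD=> D0; case: (pos0 cone); rewrite -oppr0 -{1}D0.
Qed.

End Cone.

(** * Integer affine forms and elimination of one variable *)

Notation form := (int * seq int)%type.

Section Forms.

(** A form holds a multiple of the unit and the coefficients of variables 0, 1, and so on. Missing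
    coefficients count as zero, so the longer tail is kept. *)
Fixpoint addc (s t : seq int) : seq int :=
  match s, t with
  | [::], _ => t
  | _, [::] => s
  | a :: s', b :: t' => (a + b) :: addc s' t'
  end.

Definition addf (f g : form) : form := (f.1 + g.1, addc f.2 g.2).
Definition scalef (k : int) (f : form) : form := (k * f.1, map ( *%R k) f.2).
Definition subf (f g : form) : form := addf f (scalef (-1) g).
Definition constf (k : int) : form := (k, [::]).
Definition varf (i : nat) : form := (0, rcons (nseq i 0) 1).
Definition headf (f : form) : int := head 0 f.2.
Definition tailf (f : form) : form := (f.1, behead f.2).

(** Strict positivity is the only atom, being what a positive cone interprets; weak inequalities and
    equations arise by negation. *)
Inductive lformula :=
| LTrue | LPos of form | LNot of lformula | LAnd of lformula & lformula.

Definition LOr p q := LNot (LAnd (LNot p) (LNot q)).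
Definition LIf c p q := LOr (LAnd c p) (LAnd (LNot c) q).

Fixpoint lmap (h : form -> form) (p : lformula) : lformula :=
  match p with
  | LTrue => LTrue
  | LPos f => LPos (h f)
  | LNot p => LNot (lmap h p)
  | LAnd p q => LAnd (lmap h p) (lmap h q)
  end.

Fixpoint atoms (p : lformula) : seq form :=
  match p with
  | LTrue => [::]
  | LPos f => [:: f]
  | LNot p => atoms p
  | LAnd p q => atoms p ++ atoms q
  end.

(** Besides confining variable 0 to the unit interval, the two bounds contribute the critical points
    0 and 1, so every admissible value has a critical point on each side. *)
Definition bounded (p : lformula) : lformula :=
  LAnd p (LAnd (LNot (LPos (scalef (-1) (varf 0))))
               (LNot (LPos (subf (varf 0) (constf 1))))).

(** Signs are adjusted so that a form is negative below its zero in variable 0 and positive above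
    it; forms without variable 0 have no critical point. *)
Definition normalize (f : form) : seq form :=
  if 0 < headf f then [:: f] else
  if headf f < 0 then [:: scalef (-1) f] else [::].

Definition critical (p : lformula) : seq form :=
  flatten (map normalize (atoms (bounded p))).

(* For [a] and [b] with positive coefficients on variable 0, this is a positive
   multiple of [f] at the midpoint of the zeros of [a] and [b]. *)
Definition at_midpoint (a b f : form) : form :=
  addf (scalef (headf b) (subf (scalef (headf a) (tailf f)) (scalef (headf f) (tailf a))))
       (scalef (headf a) (subf (scalef (headf b) (tailf f)) (scalef (headf f) (tailf b)))).

(* Between consecutive critical points the truth value of [p] is constant, so it
   suffices to test the midpoints of pairs of critical points. *)
Definition elim_var (p : lformula) : lformula :=
  foldr (fun ab q => LOr (lmap (at_midpoint ab.1 ab.2) (bounded p)) q) (LNot LTrue)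
        [seq (a, b) | a <- critical p, b <- critical p].

End Forms.

Section FormSemantics.
Variables (G : zmodType) (u : G) (pos : G -> Prop).
Implicit Types (e : nat -> G) (f g : form).

Fixpoint dot (s : seq int) e : G :=
  if s is c :: s' then e 0 *~ c + dot s' (fun n => e n.+1) else 0.

Definition lval e f : G := u *~ f.1 + dot f.2 e.

Fixpoint lsat e (p : lformula) : Prop :=
  match p with
  | LTrue => True
  | LPos f => pos (lval e f)
  | LNot p => ~ lsat e p
  | LAnd p q => lsat e p /\ lsat e q
  end.

Lemma lval_add e f g : lval e (addf f g) = lval e f + lval e g.
Proof.
rewrite /lval /= mulrzDr addrACA; congr (_ + _).
move: f.2 g.2 => s t; elim: s t e => [|a s IH] [|b t] e /=; rewrite ?addr0 ?add0r //.
by rewrite IH mulrzDr addrACA.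
Qed.

Lemma lval_scale e k f : lval e (scalef k f) = lval e f *~ k.
Proof.
rewrite /lval /= mulrzDl [k * _]mulrC mulrzA; congr (_ + _).
by elim: f.2 e => [|a s IH] e /=; rewrite ?mul0rz // IH mulrzDl [k * _]mulrC mulrzA.
Qed.

Lemma lval_sub e f g : lval e (subf f g) = lval e f - lval e g.
Proof. by rewrite lval_add lval_scale mulrN1z. Qed.

Lemma lval_const e k : lval e (constf k) = u *~ k.
Proof. by rewrite /lval /= addr0. Qed.

Lemma lval_var e i : lval e (varf i) = e i.
Proof.
rewrite /lval /= mulr0z add0r; elim: i e => [|i IH] e /=; first by rewrite mulr1z addr0.
by rewrite IH mulr0z add0r.
Qed.

Lemma lval_scons x e f : lval (scons x e) f = x *~ headf f + lval e (tailf f).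
Proof.
by rewrite /lval /headf; case: f => m [|c s] /=; rewrite ?mulr0z ?add0r // addrCA.
Qed.

Lemma lsat_or e p q : lsat e (LOr p q) <-> lsat e p \/ lsat e q.
Proof.
split=> [/= /not_andP|/=]; last tauto.
by case=> /contrapT; [left | right].
Qed.

Lemma lsat_if e c p q :
  lsat e (LIf c p q) <-> (lsat e c -> lsat e p) /\ (~ lsat e c -> lsat e q).
Proof. by rewrite lsat_or /=; case: (pselect (lsat e c)); tauto. Qed.

Lemma lsat_bounded e p : lsat e (bounded p) <->
  [/\ lsat e p, nneg pos (e 0) & nneg pos (u - e 0)].
Proof.
rewrite /= lval_sub lval_scale mulrN1z lval_var lval_const mulr1z /nneg opprB.
by split=> [[? []]|[]].
Qed.

Lemma lsat_map e e' (h : form -> form) p :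
    (forall f, List.In f (atoms p) -> pos (lval e (h f)) <-> pos (lval e' f)) ->
  lsat e (lmap h p) <-> lsat e' p.
Proof.
elim: p => //= [f|p IH|p IHp q IHq] hp; first by apply: hp; left.
  by rewrite IH.
by rewrite IHp ?IHq // => f fp; apply: hp; apply/List.in_or_app; tauto.
Qed.

(** The multiples of [x] cancel, so [x] is free: it is the given value when a quantifier is
    eliminated, and the midpoint itself when a witness is built. *)
Lemma lval_at_midpoint e x a b f :
  let F := lval (scons x e) in
  lval e (at_midpoint a b f) =
    (F f *~ headf a - F a *~ headf f) *~ headf b +
    (F f *~ headf b - F b *~ headf f) *~ headf a.
Proof.
rewrite /= lval_add !lval_scale !lval_sub !lval_scale !lval_scons.
have E (c d y z : G) (k l : int) :
    z = (x *~ k + y) *~ l -> c = (x *~ l + d) *~ k -> z - c = y *~ l - d *~ k.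
  move=> -> ->; rewrite !mulrzDl -!mulrzA [l * k]mulrC opprD addrACA.
  by rewrite subrr add0r.
by rewrite !(E _ _ _ _ _ _ erefl erefl).
Qed.

Lemma lsat_elim_var e p : lsat e (elim_var p) <->
  exists a b, [/\ List.In a (critical p), List.In b (critical p) &
     lsat e (lmap (at_midpoint a b) (bounded p))].
Proof.
rewrite /elim_var; set s := critical p.
have -> : lsat e (foldr (fun ab q => LOr (lmap (at_midpoint ab.1 ab.2) (bounded p)) q)
    (LNot LTrue) [seq (a, b) | a <- s, b <- s]) <->
    exists ab, List.In ab [seq (a, b) | a <- s, b <- s] /\
      lsat e (lmap (at_midpoint ab.1 ab.2) (bounded p)).
  elim: [seq _ | _ <- _, _ <- _] => [|ab l IH]; first by split=> [[]//|[? []]].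
  apply: iff_trans (lsat_or _ _ _) _; rewrite IH; split=> [[?|[ab' [? ?]]]|[ab' [[<-|]]]].
  - by exists ab; split=> //; left.
  - by exists ab'; split=> //; right.
  - by left.
  - by right; exists ab'.
have inP ab : List.In ab [seq (a, b) | a <- s, b <- s] <->
    List.In ab.1 s /\ List.In ab.2 s.
  case: ab => a b /=.
  have -> l : [seq (a, b) | a <- l, b <- s] = List.list_prod l s.
    by elim: l => //= c l <-.
  exact: List.in_prod_iff.
split=> [[[a b] [/inP[/= ? ?] ?]]|[a [b []]]]; first by exists a, b.
by exists (a, b); split=> //; apply/inP.
Qed.

Lemma critical_head p f : List.In f (critical p) -> 0 < headf f.
Proof.
rewrite /critical -/(List.In f (flatten _)); elim: (atoms _) => //= g s IH.
rewrite /normalize; case: ltP => [g0|_] /=; first by case=> [<-|].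
case: ltP => [g0|_] //= [<-|//]; rewrite /headf; case: g g0 => m [|c l] //=.
by rewrite /headf /=; lia.
Qed.

Lemma headf_scale k f : headf (scalef k f) = k * headf f.
Proof. by case: f => m [|c s]; rewrite /headf /= ?mulr0. Qed.

Lemma in_critical p f : List.In f (atoms (bounded p)) ->
  List.In f (critical p) \/ List.In (scalef (-1) f) (critical p) \/ headf f = 0.
Proof.
rewrite /critical; elim: (atoms _) => //= g s IH [<-|/IH H].
  by rewrite /normalize; case: ltgtP => [_|_|<-]; [left; left|right; left; left|right; right].
by do [case: H => [|[]]; [left|right; left|by right; right]];
   apply/List.in_or_app; right.
Qed.

Hypothesis cone : positive_cone pos.

(* Forward direction: no divisibility is needed, only signs are compared. *)
Lemma elim_var_intro e x p : nneg pos x -> nneg pos (u - x) ->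
  lsat (scons x e) p -> lsat e (elim_var p).
Proof.
move=> x0 x1 px; apply/lsat_elim_var; set F := lval (scons x e).
have hp := @critical_head p.
have inX : List.In (varf 0) (critical p).
  rewrite /critical /= map_cat flatten_cat; apply/List.in_or_app; right.
  by left.
have inX1 : List.In (subf (varf 0) (constf 1)) (critical p).
  rewrite /critical /= map_cat flatten_cat; apply/List.in_or_app; right.
  by right; left.
have FX : F (varf 0) = x by rewrite /F lval_var.
have FX1 : - F (subf (varf 0) (constf 1)) = u - x.
  by rewrite /F lval_sub lval_var lval_const mulr1z opprB.
(* The zero of [f] lies at x - F f / headf f, so maximising - F f / headf f among the forms with F f
   >= 0 gives the last critical point at or below [x]. *)
have [a [ap a0 amax]] : exists a, [/\ List.In a (critical p), nneg pos (F a) &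
    forall k, List.In k (critical p) -> nneg pos (F k) ->
      nneg pos (F k *~ headf a - F a *~ headf k)].
  have [|a [ap na ma]] := @max_ratio _ _ cone _ (critical p)
     (fun f => nneg pos (F f)) headf (fun f => - F f) hp.
    by exists (varf 0); rewrite ?FX.
  exists a; split=> // k kp nk; have := ma k kp nk.
  by rewrite !mulNrz opprK addrC.
(* Symmetrically, the first critical point at or above [x]. *)
have [b [bp b0 bmin]] : exists b, [/\ List.In b (critical p), nneg pos (- F b) &
    forall k, List.In k (critical p) -> nneg pos (- F k) ->
      nneg pos (F b *~ headf k - F k *~ headf b)].
  have [|b [bp nb mb]] := @max_ratio _ _ cone _ (critical p)
     (fun f => nneg pos (- F f)) headf F hp.
    by exists (subf (varf 0) (constf 1)); rewrite ?FX1.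
  by exists b.
exists a, b; split=> //; apply/(lsat_map (e' := scons x e)); last first.
  by apply/lsat_bounded.
move=> f fp; rewrite (lval_at_midpoint e x) -/F.
(* Either [f] or its opposite is critical and [midpoint_sign] applies, or [f] does not involve [x]
   and is merely scaled by a positive integer. *)
case/in_critical: (fp) => [fc|[fc|fc]].
- by have [] := midpoint_sign cone (hp _ ap) (hp _ bp) a0 b0 (amax _ fc) (bmin _ fc) (hp _ fc).
- have := midpoint_sign cone (hp _ ap) (hp _ bp) a0 b0 (amax _ fc) (bmin _ fc) (hp _ fc).
  have -> : F (scalef (-1) f) = - F f by rewrite /F lval_scale mulrN1z.
  rewrite headf_scale mulN1r => -[_].
  have neg A k c : (- F f) *~ k - A *~ (- c) = - (F f *~ k - A *~ c).
    by rewrite mulNrz mulrNz opprB opprK addrC.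
  by rewrite !neg !mulNrz -opprD !opprK.
- rewrite fc !mulr0z !subr0 -!mulrzA [_ b * _]mulrC -mulrzDr.
  have ? := hp _ ap; have ? := hp _ bp.
  by apply: pos_mulrzE => //; rewrite addr_gt0 // mulr_gt0.
Qed.

End FormSemantics.

(** * Witnesses for the elimination in ordered fields *)

Section RealElimination.
Variable F : realFieldType.

Definition positive (x : F) : Prop := 0 < x.

Lemma positive_cone_field : positive_cone positive.
Proof.
rewrite /positive; split=> [x y||x]; first exact: addr_gt0; first by rewrite ltxx.
have [x0|x0|->] := ltrgtP 0 x; first exact: Or31; last exact: Or32.
by apply: Or33; rewrite oppr_gt0.
Qed.

Lemma midpoint_sign_field (a b k : int) (la lb l : F) : 0 < a -> 0 < b ->
  let x := - (la / a%:~R + lb / b%:~R) / 2 in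
  ((x *~ k + l) *~ a - (x *~ a + la) *~ k) *~ b +
    ((x *~ k + l) *~ b - (x *~ b + lb) *~ k) *~ a = (x *~ k + l) *~ (2 * a * b).
Proof.
(* Midway between their zeros, the two forms, divided by their leading coefficients, take opposite
   values. *)
move=> a0 b0 x; have xE : (x *~ a + la) *~ b + (x *~ b + lb) *~ a = 0.
  by rewrite /x; field; rewrite !intr_eq0 !gt_eqF.
by rewrite -[RHS]subr0 -(mul0rz _ k) -xE; ring.
Qed.

(** Division makes the midpoint an actual element; each form has there the sign of its [at_midpoint]
    version, and [bounded] places it in [0,1]. *)
Lemma elim_var_sound e p : lsat 1 positive e (elim_var p) ->
  exists2 x : F, 0 <= x <= 1 & lsat 1 positive (scons x e) p.
Proof.
move=> /lsat_elim_var[a [b [/critical_head a0 /critical_head b0]]].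
pose x : F := 
  - (lval 1 e (tailf a) / (headf a)%:~R + lval 1 e (tailf b) / (headf b)%:~R) / 2.
have sign f : positive (lval 1 e (at_midpoint a b f)) <-> positive (lval 1 (scons x e) f).
  rewrite (lval_at_midpoint 1 e x) !lval_scons midpoint_sign_field //.
  by apply: (pos_mulrzE positive_cone_field); rewrite !mulr_gt0.
move/(lsat_map (fun f _ => sign f)).
move/lsat_bounded; rewrite /nneg /positive /= => -[px x0 x1].
by exists x => //; apply/andP; lra.
Qed.

End RealElimination.

(** * Chains inside ordered groups, and translation of formulas into linear conditions *)

Record mv_interval (C : Structure L0) (G : zmodType) (u : G) (pos : G -> Prop)
    (j : C -> G) : Prop := {
  mvi_inj : forall x y, j x = j y -> x = y;
  mvi_zero : j (s_zero C) = 0;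
  mvi_neg : forall x, j (s_neg C x) = u - j x;
  mvi_oplus : forall x y, j (s_oplus C x y) =
    if `[< pos (j x + j y - u) >] then u else j x + j y;
  mvi_delta : forall x, j (s_delta C x) = if `[< pos (u - j x) >] then 0 else u;
  mvi_ge0 : forall x, nneg pos (j x);
  mvi_le1 : forall x, nneg pos (u - j x);
  mvi_unit : pos u }.

(** A term is only piecewise affine, because truncation and Delta branch on a linear condition. The
    continuation [k] receives the form valid in each branch. *)
Fixpoint tcase (t : term L0) (k : form -> lformula) : lformula :=
  match t with
  | TVar i => k (varf i)
  | TCst c => match c with end
  | TZero => k (constf 0)
  | TNeg t => tcase t (fun f => k (subf (constf 1) f))
  | TOplus t s => tcase t (fun f => tcase s (fun g =>
      LIf (LPos (subf (addf f g) (constf 1))) (k (constf 1)) (k (addf f g))))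
  | TDelta t => tcase t (fun f =>
      LIf (LPos (subf (constf 1) f)) (k (constf 0)) (k (constf 1)))
  end.

(** The default case translates [FFalse]; on quantifiers it is a placeholder. *)
Fixpoint ltrans (p : formula L0) : lformula :=
  match p with
  | FEq t s => tcase t (fun f => tcase s (fun g =>
      LAnd (LNot (LPos (subf f g))) (LNot (LPos (subf g f)))))
  | FNot p => LNot (ltrans p)
  | FAnd p q => LAnd (ltrans p) (ltrans q)
  | FOr p q => LOr (ltrans p) (ltrans q)
  | FImp p q => LOr (LNot (ltrans p)) (ltrans q)
  | _ => LNot LTrue
  end.

Section Interval.
Variables (C : Structure L0) (G : zmodType) (u : G) (pos : G -> Prop) (j : C -> G).
Hypotheses (cone : positive_cone pos) (Cj : mv_interval u pos j).

Lemma lsat_tcase (e : nat -> C) t k P :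
    (forall f, lval u (fun n => j (e n)) f = j (eval C e t) ->
       (lsat u pos (fun n => j (e n)) (k f) <-> P)) ->
  lsat u pos (fun n => j (e n)) (tcase t k) <-> P.
Proof.
set e' := fun n => j (e n).
have ifP c p q b : (lsat u pos e' c <-> b) ->
    (b -> lsat u pos e' p <-> P) -> (~ b -> lsat u pos e' q <-> P) ->
    lsat u pos e' (LIf c p q) <-> P.
  by move=> Hc Hp Hq; rewrite lsat_if Hc; case: (pselect b) => b'; move: Hp Hq; tauto.
elim: t k P ifP => [i|[]||t IHt s IHs|t IHt|t IHt] k P ifP kP /=.
- by apply: kP; rewrite lval_var.
- by apply: kP; rewrite lval_const mulr0z (mvi_zero Cj).
- apply: (IHt) => // f fE; apply: (IHs) => // g gE.
  have E : lval u e' (subf (addf f g) (constf 1)) = j (eval C e t) + j (eval C e s) - u.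
    by rewrite lval_sub lval_add lval_const mulr1z fE gE.
  apply: (ifP _ _ _ (pos (j (eval C e t) + j (eval C e s) - u))).
  - by rewrite -E.
  - by move=> b; apply: kP; rewrite lval_const mulr1z (mvi_oplus Cj) asboolT.
  - by move=> b; apply: kP; rewrite lval_add fE gE (mvi_oplus Cj) asboolF.
- apply: (IHt) => // f fE; apply: kP.
  by rewrite lval_sub lval_const mulr1z fE (mvi_neg Cj).
- apply: (IHt) => // f fE.
  have E : lval u e' (subf (constf 1) f) = u - j (eval C e t).
    by rewrite lval_sub lval_const mulr1z fE.
  apply: (ifP _ _ _ (pos (u - j (eval C e t)))).
  - by rewrite -E.
  - by move=> b; apply: kP; rewrite lval_const mulr0z (mvi_delta Cj) asboolT.
  - by move=> b; apply: kP; rewrite lval_const mulr1z (mvi_delta Cj) asboolF.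
Qed.

Lemma lsat_ltrans (e : nat -> C) p : qfree p ->
  lsat u pos (fun n => j (e n)) (ltrans p) <-> sat C e p.
Proof.
elim: p => [|t s|p IH|p IHp q IHq|p IHp q IHq|p IHp q IHq|//|//] /=; try tauto.
- move=> _; apply: lsat_tcase => f fE; apply: lsat_tcase => g gE /=.
  rewrite !lval_sub fE gE; split=> [[n1 n2]|->]; last first.
    by rewrite subrr; split; apply: (pos0 cone).
  apply: (mvi_inj Cj); apply/eqP; rewrite -subr_eq0; apply/eqP.
  by case: (pos_total cone (j (eval C e t) - j (eval C e s))) => //; rewrite opprB.
- case=> /IHp hp /IHq hq; rewrite hp hq.
  by case: (pselect (sat C e p)); case: (pselect (sat C e q)); tauto.
- case=> /IHp hp /IHq hq; rewrite hp hq.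
  by case: (pselect (sat C e p)); case: (pselect (sat C e q)); tauto.
Qed.

End Interval.

(** * Transfer of satisfiability from an ordered group to an ordered field *)

Section Transfer.
Variables (F : realFieldType) (G : zmodType) (u : G) (pos : G -> Prop).
Hypotheses (cone : positive_cone pos) (upos : pos u).

(* Once all variables are eliminated, only the signs of integer multiples of
   the unit matter, and these do not depend on the group. *)
Lemma lsat_transfer k (e : nat -> G) p :
    (forall n, nneg pos (e n) /\ nneg pos (u - e n)) ->
    (forall n, (k <= n)%N -> e n = 0) -> lsat u pos e p ->
  exists2 e' : nat -> F, (forall n, 0 <= e' n <= 1) & lsat 1 (@positive F) e' p.
Proof.
elim: k e p => [|k IH] e p be e0.
  move=> pe; exists (fun=> 0) => [n|]; first by rewrite lexx ler01.
  suff <- : lsat u pos e p <-> lsat (1 : F) (@positive F) (fun=> 0) p by [].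
  elim: p {pe} => [//|[m s]|p IHp|p IHp q IHq] /=; [|tauto..].
  have dot0 (H : zmodType) (x : nat -> H) : (forall n, x n = 0) -> dot s x = 0.
    by elim: s x => //= c s IHs x x0; rewrite IHs // x0 mul0rz addr0.
  rewrite /lval /= !dot0 // => [|n]; last exact: e0.
  rewrite !addr0 /positive ltr0z; case: (ltgtP m 0) => [m0|m0|->].
  - split=> // pm; have := pos_mulrz cone (_ : 0 < - m) upos.
    by rewrite oppr_gt0 mulrNz => /(_ m0)/(pos_opp cone); rewrite opprK.
  - by split=> // _; apply: pos_mulrz.
  - by rewrite mulr0z; split=> // /(pos0 cone).
(* Variable 0 is eliminated in [G], the result transferred by induction, and a value for variable 0
   recovered in [F]. *)
move=> pe; have eE : e = scons (e 0%N) (fun n => e n.+1).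
  by apply: funext => -[].
have [||/= e' be' /elim_var_sound[x bx px]] :=
  IH (fun n => e n.+1) (elim_var p) (fun n => be n.+1).
- by move=> n kn; apply: e0.
- by have [? ?] := be 0%N; apply: (elim_var_intro cone (x := e 0%N)) => //; rewrite -eE.
by exists (scons x e') => // -[|n] /=.
Qed.

End Transfer.

(** * The standard chain on the unit interval of an ordered field *)

Section UnitChain.
Variable F : realFieldType.

Definition unit_interval := {x : F | 0 <= x <= 1}.
Implicit Types x y : unit_interval.

Fact unit_oplus_subproof x y :
  0 <= (if 1 < val x + val y then 1 else val x + val y) <= 1.
Proof. by case: x y => [x /= hx] [y /= hy]; case: ltP => h; apply/andP; lra. Qed.
Fact unit_neg_subproof x : 0 <= 1 - val x <= 1.
Proof. by case: x => [x /= hx]; apply/andP; lra. Qed.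
Fact unit_zero_subproof : 0 <= (0 : F) <= 1.
Proof. by rewrite lexx ler01. Qed.
Fact unit_delta_subproof x : 0 <= (if val x == 1 then 1 else 0 : F) <= 1.
Proof. by case: eqP; rewrite ?lexx ?ler01. Qed.

Definition unit_chain : Structure L0 := {|
  carrier := unit_interval;
  s_oplus x y := @exist F (fun t => 0 <= t <= 1) _ (unit_oplus_subproof x y);
  s_neg x := @exist F (fun t => 0 <= t <= 1) _ (unit_neg_subproof x);
  s_zero := @exist F (fun t => 0 <= t <= 1) _ unit_zero_subproof;
  s_delta x := @exist F (fun t => 0 <= t <= 1) _ (unit_delta_subproof x);
  s_const (c : L0) := match c with end |}.

Lemma unit_chain_interval : mv_interval (1 : F) (@positive F) (val : unit_chain -> F).
Proof.
have bnd (x : unit_chain) : 0 <= val x <= 1 by apply: (valP x).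
split=> //=; rewrite /nneg /positive; last exact: ltr01.
- by move=> x y /val_inj.
- by move=> x y; congr (if _ then _ else _); apply/idP/asboolP; rewrite subr_gt0.
- move=> x; case: eqP => [->|x1]; first by rewrite asboolF // subrr ltxx.
  rewrite asboolT // subr_gt0 lt_neqAle; have /andP[_ ->] := bnd x.
  by rewrite andbT; apply/eqP.
- by move=> x; apply/negP; rewrite -leNgt oppr_le0; case/andP: (bnd x).
- by move=> x; apply/negP; rewrite -leNgt opprB subr_le0; case/andP: (bnd x).
Qed.

Lemma unit_chain_MVDelta : is_MVDelta_chain unit_chain.
Proof.
have bnd (x : unit_chain) : 0 <= val x <= 1 by apply: (valP x).
split; [split|split] => /=.
- case=> a /= ha [b /= hb] [c /= hc]; apply: val_inj => /=.
  case: (ltP 1 (a + b)) => ?; case: (ltP 1 (b + c)) => ?;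
  by case: ltP => ?; case: ltP => ?; lra.
- split=> [x y|]; first by apply: val_inj; rewrite /= addrC.
  split=> [x|].
    by apply: val_inj; rewrite /= addr0 ltNge; have /andP[_ ->] := bnd x.
  split=> [x|]; first by apply: val_inj; rewrite /= opprB addrC subrK.
  split=> [[a /= ha]|[a /= ha] [b /= hb]]; apply: val_inj => /=.
    by case: ltP => ?; lra.
  case: (ltP 1 (1 - a + b)) => ?; case: (ltP 1 (1 - b + a)) => ?;
  by case: ltP => ?; case: ltP => ?; lra.
- case=> [a /= ha] [b /= hb]; rewrite /mv_le /mv_join.
  have [ab|/ltW ba] := leP a b; [left|right]; apply: val_inj => /=.
    by case: (ltP 1 (1 - a + b)) => ?; case: ltP => ?; lra.
  by case: (ltP 1 (1 - b + a)) => ?; case: ltP => ?; lra.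
- move=> x; split=> [->|x1]; apply: val_inj => /=; first by rewrite subr0 eqxx.
  by case: eqP => // x1'; case: x1; apply: val_inj; rewrite /= subr0.
Qed.

End UnitChain.

(** * The ordered group of an MV-chain *)

Section MVTheory.
Variable C : Structure L0.
Hypothesis isMV : is_MV C.
Local Notation "x ⊕ y" := (s_oplus C x y) (at level 50, left associativity).
Local Notation "¬ x" := (s_neg C x) (at level 35, right associativity).
Local Notation one := (mv_one C).
Local Notation zero := (s_zero C).
Implicit Types x y z a b c : C.

Definition mv_odot x y : C := ¬ (¬ x ⊕ ¬ y).
Local Notation "x ⊙ y" := (mv_odot x y) (at level 40, left associativity).

Lemma mvA x y z : x ⊕ (y ⊕ z) = x ⊕ y ⊕ z. Proof. by case: isMV. Qed.
Lemma mvC x y : x ⊕ y = y ⊕ x. Proof. by case: isMV => _ []. Qed.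
Lemma mvx0 x : x ⊕ zero = x. Proof. by case: isMV => _ [_ []]. Qed.
Lemma mvNN x : ¬ ¬ x = x. Proof. by case: isMV => _ [_ [_ []]]. Qed.
Lemma mvx1 x : x ⊕ one = one. Proof. by case: isMV => _ [_ [_ [_ []]]]. Qed.
Lemma mvL x y : ¬ (¬ x ⊕ y) ⊕ y = ¬ (¬ y ⊕ x) ⊕ x.
Proof. by case: isMV => _ [_ [_ [_ []]]]. Qed.

Lemma mv0x x : zero ⊕ x = x. Proof. by rewrite mvC mvx0. Qed.
Lemma mv1x x : one ⊕ x = one. Proof. by rewrite mvC mvx1. Qed.
Lemma mvN1 : ¬ one = zero. Proof. exact: mvNN. Qed.
Lemma mvNx x : ¬ x ⊕ x = one.
Proof. by have := mvL x one; rewrite !mvx1 mvN1 mv0x. Qed.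

Lemma mvAC x y z : x ⊕ y ⊕ z = x ⊕ z ⊕ y.
Proof. by rewrite -!mvA (mvC y). Qed.
Lemma mvCA x y z : x ⊕ (y ⊕ z) = y ⊕ (x ⊕ z).
Proof. by rewrite !mvA (mvC x). Qed.

Lemma mv_odotC x y : x ⊙ y = y ⊙ x. Proof. by rewrite /mv_odot mvC. Qed.
Lemma mv_odotCA x y z : x ⊙ (y ⊙ z) = y ⊙ (x ⊙ z).
Proof. by rewrite /mv_odot !mvNN mvCA. Qed.

Lemma mv_leP x y : mv_le C x y <-> ¬ x ⊕ y = one.
Proof.
split=> [<-|xy]; last by rewrite /mv_le /mv_join xy mvN1 mv0x.
by rewrite /mv_join mvCA mvNx.
Qed.

Lemma mv_oplus_eq0 x y : x ⊕ y = zero -> x = zero.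
Proof.
move=> xy; have: ¬ x ⊕ (x ⊕ y) = one by rewrite mvA mvNx mv1x.
by rewrite xy mvx0 -{2}(mvNN x) => ->; rewrite mvN1.
Qed.

Lemma mv_odot_eq1 x y : x ⊙ y = one -> x = one.
Proof.
move/(congr1 (s_neg C)); rewrite mvNN mvN1 => /mv_oplus_eq0 /(congr1 (s_neg C)).
by rewrite mvNN.
Qed.

(* Partial subtraction: if x + y <= 1 then (1 - (x + y)) + y = 1 - x. *)
Lemma mv_cancel x y : ¬ x ⊕ ¬ y = one -> ¬ (x ⊕ y) ⊕ y = ¬ x.
Proof.
by move=> xy; have := mvL (¬ x) y; rewrite mvNN mvC (mvC (¬ y)) xy mvN1 mv0x mvC.
Qed.

(** This identity, its dual [mv_oplus_odot_swap] and [mv_odot_oplus_exchange] compare fractional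
    parts in x + (y + z) = y + (x + z), according to the carries of x + z and y + z. Here
    cancellation makes both sides the negation of the same sum of ¬(x ⊕ z), ¬(y ⊕ z) and z. *)
Lemma mv_odot_oplus_swap x y z : ¬ x ⊕ ¬ z = one -> ¬ y ⊕ ¬ z = one ->
  x ⊙ (y ⊕ z) = y ⊙ (x ⊕ z).
Proof.
move=> xz yz; rewrite /mv_odot; congr (¬ _).
by rewrite -(mv_cancel xz) -(mv_cancel yz) mvAC [RHS]mvAC (mvC (¬ (x ⊕ z))).
Qed.

Lemma mv_oplus_odot_swap x y z : x ⊕ z = one -> y ⊕ z = one ->
  x ⊕ (y ⊙ z) = y ⊕ (x ⊙ z).
Proof.
move=> xz yz; have := @mv_odot_oplus_swap (¬ x) (¬ y) (¬ z).
by rewrite /mv_odot !mvNN => /(_ xz yz)/(congr1 (s_neg C)); rewrite !mvNN.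
Qed.

Lemma mv_odot_oplus_exchange x y z : x ⊕ z = one -> ¬ y ⊕ ¬ z = one ->
  x ⊙ (y ⊕ z) = y ⊕ (x ⊙ z).
Proof.
(* Here [p] is 1 - (y + z) and [r] is x + z - 1. Then x = r + y + p, and taking [p] away from x
   leaves y + r. *)
move=> xz yz; pose p := ¬ (y ⊕ z); pose r := x ⊙ z.
have pE : p ⊕ y = ¬ z by rewrite /p (mvC y) mv_cancel // mvC.
have rE : r ⊕ ¬ z = x.
  by rewrite /r /mv_odot mv_cancel ?mvNN.
have rz : ¬ r ⊕ z = one by rewrite /r /mv_odot mvNN -mvA mvNx mvx1.
have zE : z = r ⊕ ¬ (¬ z ⊕ r) by rewrite mvC mvL rz mvN1 mv0x.
have rp : ¬ (r ⊕ y) ⊕ ¬ p = one.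
  by rewrite /p mvNN {1}zE (mvCA y) !mvA -(mvA _ r) mvNx mv1x.
have xE : x = r ⊕ y ⊕ p by rewrite -mvA (mvC y) pE rE.
by rewrite /mv_odot -/p {1}xE (mv_cancel rp) mvNN mvC.
Qed.


Hypothesis chain : forall x y, mv_le C x y \/ mv_le C y x.

Lemma mv_no_carry x y : x ⊕ y <> one -> ¬ x ⊕ ¬ y = one.
Proof. by case: (chain x (¬ y)) => /mv_leP //; rewrite mvNN mvC. Qed.

Hypothesis nontrivial : zero <> one.

(* The pair [Chang n c] stands for n + c in the group extending [C]. *)
Record chang := Chang { chang_int : int; chang_frac : C; _ : chang_frac <> one }.
Implicit Types g h : chang.

HB.instance Definition _ := gen_eqMixin chang.
HB.instance Definition _ := gen_choiceMixin chang.

Lemma chang_eq g h :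
  chang_int g = chang_int h -> chang_frac g = chang_frac h -> g = h.
Proof.
by case: g h => [n c c1] [m d d1] /= -> cd; subst d; congr Chang; apply: Prop_irrelevance.
Qed.

Lemma chang_frac_lt1 g : chang_frac g <> one. Proof. by case: g. Qed.

Definition of_int (n : int) : chang := Chang n nontrivial.

Lemma carry_lt1 x y : x <> one -> x ⊙ y <> one.
Proof. by move=> x1 /mv_odot_eq1. Qed.

(** Addition with carry: once the fractions reach one, their excess over one is given by
    [mv_odot]. *)
Definition chang_add g h : chang :=
  match pselect (chang_frac g ⊕ chang_frac h = one) with
  | left _ => Chang (chang_int g + chang_int h + 1)
                    (@carry_lt1 _ (chang_frac h) (@chang_frac_lt1 g))
  | right lt1 => Chang (chang_int g + chang_int h) lt1
  end.

Lemma neg_lt1 x : x <> zero -> ¬ x <> one.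
Proof. by move=> x0 /(congr1 (s_neg C)); rewrite mvNN mvN1. Qed.

Definition chang_opp g : chang :=
  match pselect (chang_frac g = zero) with
  | left _ => of_int (- chang_int g)
  | right n0 => Chang (- chang_int g - 1) (neg_lt1 n0)
  end.

Lemma chang_addT g h : chang_frac g ⊕ chang_frac h = one ->
  chang_int (chang_add g h) = chang_int g + chang_int h + 1 /\
  chang_frac (chang_add g h) = chang_frac g ⊙ chang_frac h.
Proof. by rewrite /chang_add; case: pselect. Qed.

Lemma chang_addF g h : chang_frac g ⊕ chang_frac h <> one ->
  chang_int (chang_add g h) = chang_int g + chang_int h /\
  chang_frac (chang_add g h) = chang_frac g ⊕ chang_frac h.
Proof. by rewrite /chang_add; case: pselect. Qed.

Lemma chang_addC : commutative chang_add.
Proof.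
move=> g h; case: (pselect (chang_frac g ⊕ chang_frac h = one)) => gh.
  have hg : chang_frac h ⊕ chang_frac g = one by rewrite mvC.
  have [i1 f1] := chang_addT gh; have [i2 f2] := chang_addT hg.
  by apply: chang_eq; rewrite ?i1 ?i2 ?f1 ?f2; [lia | rewrite mv_odotC].
have hg : chang_frac h ⊕ chang_frac g <> one by rewrite mvC.
have [i1 f1] := chang_addF gh; have [i2 f2] := chang_addF hg.
by apply: chang_eq; rewrite ?i1 ?i2 ?f1 ?f2; [lia | rewrite mvC].
Qed.

Lemma chang_addCA_mixed g h k :
    chang_frac g ⊕ chang_frac k = one -> chang_frac h ⊕ chang_frac k <> one ->
  chang_add g (chang_add h k) = chang_add h (chang_add g k).
Proof.
move=> gk hk; have [i1 f1] := chang_addT gk; have [i2 f2] := chang_addF hk.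
have ex := mv_odot_oplus_exchange gk (mv_no_carry hk).
have ghk : chang_frac g ⊕ chang_frac (chang_add h k) = one.
  by rewrite f2 mvCA gk mvx1.
have hgk : chang_frac h ⊕ chang_frac (chang_add g k) <> one.
  by rewrite f1 -ex mv_odotC; apply: carry_lt1.
have [i3 f3] := chang_addT ghk; have [i4 f4] := chang_addF hgk.
by apply: chang_eq; rewrite ?i3 ?i4 ?f3 ?f4 ?f1 ?f2 ?i1 ?i2 //; lia.
Qed.

(** With commutativity this yields associativity. It is symmetric in [g] and [h], so the two mixed
    carry patterns reduce to one lemma. *)
Lemma chang_addCA : left_commutative chang_add.
Proof.
move=> g h k.
case: (pselect (chang_frac g ⊕ chang_frac k = one)) => gk;
case: (pselect (chang_frac h ⊕ chang_frac k = one)) => hk; first last.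
- have [i1 f1] := chang_addF gk; have [i2 f2] := chang_addF hk.
  have eqT : chang_frac g ⊕ chang_frac (chang_add h k) =
             chang_frac h ⊕ chang_frac (chang_add g k) by rewrite f1 f2 mvCA.
  case: (pselect (chang_frac g ⊕ chang_frac (chang_add h k) = one)) => ghk.
    have [i3 f3] := chang_addT ghk; rewrite eqT in ghk.
    have [i4 f4] := chang_addT ghk.
    apply: chang_eq; rewrite ?i3 ?i4 ?f3 ?f4 ?f1 ?f2 ?i1 ?i2; first by lia.
    by apply: mv_odot_oplus_swap; apply: mv_no_carry.
  have [i3 f3] := chang_addF ghk; rewrite eqT in ghk.
  have [i4 f4] := chang_addF ghk.
  by apply: chang_eq; [rewrite i3 i4 i1 i2; lia | rewrite f3 f4].
- by rewrite (chang_addCA_mixed hk gk).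
- exact: chang_addCA_mixed.
have [i1 f1] := chang_addT gk; have [i2 f2] := chang_addT hk.
have eqT : chang_frac g ⊕ chang_frac (chang_add h k) =
           chang_frac h ⊕ chang_frac (chang_add g k).
  by rewrite f1 f2; apply: mv_oplus_odot_swap.
case: (pselect (chang_frac g ⊕ chang_frac (chang_add h k) = one)) => ghk.
  have [i3 f3] := chang_addT ghk; rewrite eqT in ghk.
  have [i4 f4] := chang_addT ghk.
  apply: chang_eq; rewrite ?i3 ?i4 ?f3 ?f4 ?f1 ?f2 ?i1 ?i2; first by lia.
  exact: mv_odotCA.
have [i3 f3] := chang_addF ghk; rewrite eqT in ghk.
have [i4 f4] := chang_addF ghk.
by apply: chang_eq; [rewrite i3 i4 i1 i2; lia | rewrite f3 f4].
Qed.

Lemma chang_addA : associative chang_add.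
Proof. by move=> g h k; rewrite (chang_addC h) chang_addCA chang_addC. Qed.

Lemma chang_add0 : left_id (of_int 0) chang_add.
Proof.
move=> g; have g1 : chang_frac (of_int 0) ⊕ chang_frac g <> one.
  by rewrite mv0x; apply: chang_frac_lt1.
by have [i f] := chang_addF g1; apply: chang_eq; rewrite ?i ?f ?mv0x //= add0r.
Qed.

Lemma chang_addN : left_inverse (of_int 0) chang_opp chang_add.
Proof.
move=> g; rewrite /chang_opp; case: pselect => [g0|n0].
  have g1 : chang_frac (of_int (- chang_int g)) ⊕ chang_frac g <> one.
    by rewrite mv0x; apply: chang_frac_lt1.
  by have [i f] := chang_addF g1; apply: chang_eq; rewrite ?i ?f ?mv0x //= addNr.
set h := Chang _ _; have gh : chang_frac h ⊕ chang_frac g = one by rewrite mvNx.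
have [i f] := chang_addT gh; apply: chang_eq; rewrite ?i ?f /=; first by lia.
by rewrite /mv_odot mvNN mvC mvNx mvN1.
Qed.

HB.instance Definition _ :=
  GRing.isZmodule.Build chang chang_addA chang_addC chang_add0 chang_addN.

Definition chang_pos g : Prop :=
  0 < chang_int g \/ chang_int g = 0 /\ chang_frac g <> zero.

Lemma chang_cone : positive_cone chang_pos.
Proof.
split=> [g h||g].
- have addE : g + h = chang_add g h by [].
  case: (pselect (chang_frac g ⊕ chang_frac h = one)) => gh.
    have [i f] := chang_addT gh; move=> pg ph; left.
    by rewrite addE i; case: pg => [|[]]; case: ph => [|[]]; lia.
  have [i f] := chang_addF gh; rewrite /chang_pos addE i f.
  case=> [pg|[-> g0]]; case=> [ph|[-> h0]]; try by left; lia.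
  by right; rewrite addr0; split=> // /mv_oplus_eq0.
- by case=> [//|[_]]; apply.
- rewrite /chang_pos -/(chang_opp g); have [g0|g0|g0] := ltrgtP 0 (chang_int g).
  + by apply: Or31; left.
  + apply: Or33; rewrite -[- g]/(chang_opp g) /chang_opp; case: pselect => z /=.
      by left; lia.
    case: (eqVneq (chang_int g) (-1)) => [->|n1]; last by left; lia.
    right; split=> // /(congr1 (s_neg C)); rewrite mvNN -/one => ?.
    by apply: (@chang_frac_lt1 g).
  + case: (pselect (chang_frac g = zero)) => z; last by apply: Or31; right.
    by apply: Or32; apply: chang_eq.
Qed.

Definition chang_unit : chang := of_int 1.

(** Fractions stay below one, so the top element has to become the integer 1. *)
Definition chang_embed x : chang :=
  match pselect (x = one) with
  | left _ => chang_unit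
  | right x1 => Chang 0 x1
  end.

Hypothesis deltaC : forall x, (x = one -> s_delta C x = one) /\
                              (x <> one -> s_delta C x = zero).

Lemma chang_embed1 : chang_embed one = chang_unit.
Proof. by rewrite /chang_embed; case: pselect. Qed.

Lemma chang_embedE x (x1 : x <> one) : chang_embed x = Chang 0 x1.
Proof. by rewrite /chang_embed; case: pselect => // ?; apply: chang_eq. Qed.

Lemma chang_embedN x : chang_embed (¬ x) = chang_unit - chang_embed x.
Proof.
apply/eqP; rewrite eq_sym subr_eq eq_sym; apply/eqP.
case: (pselect (x = one)) => [->|x1].
  by rewrite mvN1 chang_embed1 (chang_embedE nontrivial) add0r.
case: (pselect (x = zero)) => [->|x0].
  by rewrite chang_embed1 (chang_embedE nontrivial) addr0.
rewrite (chang_embedE x1) (chang_embedE (neg_lt1 x0)).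
set g := Chang _ _; set h := Chang _ _.
have gh : chang_frac g ⊕ chang_frac h = one by rewrite mvNx.
have [i f] := chang_addT gh; apply: chang_eq; rewrite ?i ?f //=.
by rewrite /mv_odot mvNN mvC mvNx mvN1.
Qed.

Lemma chang_embed0 : chang_embed zero = 0.
Proof. by rewrite (chang_embedE nontrivial). Qed.

Lemma chang_embed_pos x : x <> zero -> chang_pos (chang_embed x).
Proof.
move=> x0; case: (pselect (x = one)) => [->|x1].
  by rewrite chang_embed1; left.
by rewrite (chang_embedE x1); right.
Qed.

Lemma chang_embed_nneg x : nneg chang_pos (chang_embed x).
Proof.
apply/(nnegP chang_cone); case: (pselect (x = zero)) => [->|x0].
  by right; apply: chang_embed0.
by left; apply: chang_embed_pos.
Qed.

Lemma chang_embed_carry x y : x <> one -> y <> one -> x ⊕ y = one ->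
  chang_embed x + chang_embed y = chang_embed (x ⊙ y) + chang_unit.
Proof.
move=> x1 y1 xy; rewrite (chang_embedE x1) (chang_embedE y1).
rewrite (chang_embedE (@carry_lt1 _ y x1)).
set g := Chang _ x1; set h := Chang _ y1; set k := Chang _ _.
have gh : chang_frac g ⊕ chang_frac h = one by [].
have k1 : chang_frac k ⊕ chang_frac chang_unit <> one.
  by rewrite mvx0; apply: chang_frac_lt1.
have [i f] := chang_addT gh; have [i' f'] := chang_addF k1.
by apply: chang_eq; rewrite ?i ?i' // f f' mvx0.
Qed.

Lemma chang_embedD x y : x ⊕ y <> one ->
  chang_embed x + chang_embed y = chang_embed (x ⊕ y).
Proof.
move=> xy; have x1 : x <> one by move=> x1; apply: xy; rewrite x1 mv1x.
have y1 : y <> one by move=> y1; apply: xy; rewrite y1 mvx1.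
rewrite (chang_embedE x1) (chang_embedE y1) (chang_embedE xy).
by have [i f] := @chang_addF (Chang 0 x1) (Chang 0 y1) xy; apply: chang_eq.
Qed.

Lemma chang_embed_oplus x y : chang_embed (x ⊕ y) =
  if `[< chang_pos (chang_embed x + chang_embed y - chang_unit) >] then chang_unit
  else chang_embed x + chang_embed y.
Proof.
(* If one summand is the unit, the sum exceeds it unless the other summand is zero; both branches
   then give the unit. *)
have unit_case z : chang_unit = if `[< chang_pos (chang_unit + chang_embed z - chang_unit) >]
    then chang_unit else chang_unit + chang_embed z.
  rewrite addrAC subrr add0r; case: asboolP => // npos.
  by have /(nnegP chang_cone)[//|->] := @chang_embed_nneg z; rewrite addr0.
case: (pselect (x = one)) => [->|x1].
  by rewrite mv1x chang_embed1; apply: unit_case.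
case: (pselect (y = one)) => [->|y1].
  by rewrite mvx1 chang_embed1 (addrC (chang_embed x)); apply: unit_case.
case: (pselect (x ⊕ y = one)) => xy.
  rewrite xy chang_embed_carry // addrK chang_embed1; case: asboolP => // npos.
  by have /(nnegP chang_cone)[//|->] := @chang_embed_nneg (x ⊙ y); rewrite add0r.
rewrite chang_embedD // asboolF // -opprB -chang_embedN.
exact: chang_embed_nneg.
Qed.

Lemma chang_interval : mv_interval chang_unit chang_pos chang_embed.
Proof.
split.
- move=> x y; case: (pselect (x = one)) => x1; case: (pselect (y = one)) => y1.
  + by rewrite x1 y1.
  + by rewrite x1 chang_embed1 (chang_embedE y1) => /(congr1 chang_int).
  + by rewrite y1 chang_embed1 (chang_embedE x1) => /(congr1 chang_int).
  + by rewrite (chang_embedE x1) (chang_embedE y1) => /(congr1 chang_frac).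
- exact: chang_embed0.
- exact: chang_embedN.
- exact: chang_embed_oplus.
- move=> x; case: (pselect (x = one)) => [->|x1].
    rewrite (proj1 (deltaC one)) // chang_embed1 subrr asboolF //.
    exact: (pos0 chang_cone).
  rewrite (proj2 (deltaC x)) // -chang_embedN asboolT ?chang_embed0 //.
  by apply: chang_embed_pos => /(congr1 (s_neg C)); rewrite mvNN.
- exact: chang_embed_nneg.
- by move=> x; rewrite -chang_embedN; apply: chang_embed_nneg.
- by left.
Qed.

End MVTheory.

Lemma chain_sat_transfer (F : realFieldType) (C : Structure L0) p (e : nat -> C) :
    is_MVDelta_chain C -> s_zero C <> mv_one C -> qfree p ->
  sat C e p -> exists e' : nat -> unit_chain F, sat (unit_chain F) e' p.
Proof.
move=> [mv [chain deltaC]] nt qp; have [k kp] := closed_exists p.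
have cone := chang_cone mv chain nt; have Cj := chang_interval mv chain nt deltaC.
(* Values beyond the free variables of [p] are set to zero, leaving finitely many variables to
   eliminate. *)
pose e0 n := if (n < k)%N then e n else s_zero C.
rewrite (sat_ext (e' := e0) kp) => [|n nk]; last by rewrite /e0 nk.
move/(lsat_ltrans cone Cj e0 qp)/(lsat_transfer F cone (mvi_unit Cj) (k := k)).
case=> [n|n kn|e' be' pe'].
- by split; [apply: (mvi_ge0 Cj) | apply: (mvi_le1 Cj)].
- by rewrite /e0 ltnNge kn /= (mvi_zero Cj).
exists (fun n => @exist F (fun t => 0 <= t <= 1) _ (be' n)).
by apply/(lsat_ltrans (@positive_cone_field F) (unit_chain_interval F)).
Qed.

(** * Quantifier elimination for periodic sequences *)

Definition TOne {C} : term C := TNeg TZero.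
Definition TOdot {C} (t s : term C) : term C := TNeg (TOplus (TNeg t) (TNeg s)).

(** Denotes [m] plus the sum of [s], truncated to [0,1]; summands are added one at a time by the
    identity in [clamp_step]. *)
Fixpoint clamp_term (s : seq (term L0)) (m : int) : term L0 :=
  if s is t :: s' then TOdot (TOplus (clamp_term s' m) t) (clamp_term s' (m + 1))
  else if 0 < m then TOne else TZero.

(** A multiple c x is cut into |c| summands from [0,1]: copies of x, or of 1 - x when c < 0. The
    latter exceed c x by |c|, which [coef_shift] corrects. *)
Fixpoint coef_terms (i : nat) (s : seq int) : seq (term L0) :=
  if s is c :: s' then
    nseq `|c|%N (if 0 <= c then TVar i else TNeg (TVar i)) ++ coef_terms i.+1 s'
  else [::].

Fixpoint coef_shift (s : seq int) : int :=
  if s is c :: s' then (if 0 <= c then 0 else c) + coef_shift s' else 0.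

Definition form_term (f : form) : term L0 :=
  clamp_term (coef_terms 0 f.2) (f.1 + coef_shift f.2).

(** On the unit chain the values are only 0 and 1, where negation and [TOdot] are Boolean; the
    pattern ¬ Δ ¬ tests for being nonzero. *)
Fixpoint lterm (p : lformula) : term L0 :=
  match p with
  | LTrue => TOne
  | LPos f => TNeg (TDelta (TNeg (form_term f)))
  | LNot p => TNeg (lterm p)
  | LAnd p q => TOdot (lterm p) (lterm q)
  end.

Section LTerm.
Variable F : realFieldType.
Local Notation B := (unit_chain F).
Implicit Types (e : nat -> B).

Definition clamp (x : F) : F := if x < 0 then 0 else if 1 < x then 1 else x.

Lemma clamp_le0 (x : F) : x <= 0 -> clamp x = 0.
Proof. by rewrite /clamp; case: ltP => // ?; case: ltP => ?; lra. Qed.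

Lemma clamp_ge1 (x : F) : 1 <= x -> clamp x = 1.
Proof. by rewrite /clamp; case: ltP => ?; [lra|case: ltP => ?; lra]. Qed.

Lemma clamp_id (x : F) : 0 <= x <= 1 -> clamp x = x.
Proof. by move=> /andP[? ?]; rewrite /clamp; case: ltP => ?; [lra|case: ltP => ?; lra]. Qed.

Lemma clamp_gt0 (x : F) : (0 < clamp x) = (0 < x).
Proof.
rewrite /clamp; case: (ltP x 0) => [x0|x0]; first by rewrite ltxx ltNge ltW.
by case: (ltP 1 x) => // x1; rewrite ltr01 (lt_trans ltr01 x1).
Qed.

(* Rose and Rosser's identity, reading the right-hand side as
   [(clamp x (+) y) (.) clamp (x + 1)]. *)
Lemma clamp_step (x y : F) : 0 <= y <= 1 ->
  let z := if 1 < clamp x + y then 1 else clamp x + y in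
  1 - (if 1 < (1 - z) + (1 - clamp (x + 1)) then 1 else (1 - z) + (1 - clamp (x + 1))) =
  clamp (x + y).
Proof.
move=> /andP[y0 y1]; cbv zeta.
have [x0|x0] := leP x 0.
  rewrite [clamp x]clamp_le0 // add0r [1 < y]ltNge y1 /=.
  have [x1|x1] := leP (x + 1) 0.
    rewrite !clamp_le0 //; last lra.
    by case: ltP => ?; lra.
  rewrite (@clamp_id (x + 1)); last by apply/andP; lra.
  case: ltP => ?; first by rewrite clamp_le0; lra.
  by rewrite clamp_id; [lra|apply/andP; lra].
rewrite [clamp (x + 1)]clamp_ge1; last lra.
have [x1|x1] := leP x 1.
  rewrite [clamp x]clamp_id; last by apply/andP; lra.
  case: (ltP 1 (x + y)) => ?; first by rewrite clamp_ge1; [case: ltP => ?; lra|lra].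
  by rewrite clamp_id; [case: ltP => ?; lra|apply/andP; lra].
rewrite [clamp x]clamp_ge1 ?[clamp (x + y)]clamp_ge1; try lra.
by case: (ltP 1 (1 + y)) => ?; case: ltP => ?; lra.
Qed.

Lemma eval_TOdot e t s : val (eval B e (TOdot t s)) =
  1 - (if 1 < (1 - val (eval B e t)) + (1 - val (eval B e s)) then 1
       else (1 - val (eval B e t)) + (1 - val (eval B e s))).
Proof. by []. Qed.

Lemma eval_clamp_term e s m : val (eval B e (clamp_term s m)) =
  clamp (m%:~R + \sum_(t <- s) val (eval B e t)).
Proof.
elim: s m => [|t s IH] m.
  rewrite big_nil addr0 /=; case: ltP => m0 /=.
    by rewrite subr0 clamp_ge1 // ler1z; lia.
  by rewrite clamp_le0 // lerz0.
rewrite big_cons [clamp_term _ _]/= eval_TOdot.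
rewrite [val (eval B e (TOplus _ _))]/= -/unit_interval !IH.
have by01 : 0 <= val (eval B e t) <= 1 := valP (eval B e t).
have reorder (x y z : F) : x + (y + z) = x + z + y by rewrite addrCA addrC.
by rewrite [in RHS]reorder -(clamp_step _ by01) /= intrD (addrAC _ 1).
Qed.

Lemma sum_coef_terms e i s :
  (coef_shift s)%:~R + \sum_(t <- coef_terms i s) val (eval B e t) =
  dot s (fun n => val (e (i + n)%N)).
Proof.
elim: s i => [|c s IH] i /=; first by rewrite big_nil addr0.
rewrite big_cat /= intrD addrACA addn0; congr (_ + _).
  rewrite big_nseq; case: ifP => c0 /=.
    by rewrite add0r -[in RHS](gez0_abs c0) iter_addr addr0 pmulrn.
  rewrite iter_addr addr0 pmulrn ltz0_abs; last by rewrite ltNge c0.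
  by rewrite mulrzBl !mulrNz opprK addrA addrN add0r.
by rewrite IH; congr (dot s _); apply: funext => n; rewrite addSnnS.
Qed.

Lemma eval_form_term e f :
  val (eval B e (form_term f)) = clamp (lval 1 (fun n => val (e n)) f).
Proof. by rewrite eval_clamp_term intrD -addrA sum_coef_terms. Qed.

Lemma eval_lterm e p : val (eval B e (lterm p)) =
  if `[< lsat 1 (@positive F) (fun n => val (e n)) p >] then 1 else 0.
Proof.
elim: p => [|f|p IH|p IHp q IHq].
- by rewrite asboolT //= subr0.
- have -> : val (eval B e (lterm (LPos f))) =
     1 - (if 1 - val (eval B e (form_term f)) == 1 then 1 else 0) by [].
  rewrite eval_form_term; set x := lval _ _ _.
  rewrite [`[< _ >]](_ : _ = (0 < x)); last by apply/asboolP/idP.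
  rewrite -clamp_gt0 -subr_eq0 addrAC subrr add0r oppr_eq0.
  have : 0 <= clamp x by rewrite /clamp; case: (ltP x 0) => // ?; case: ltP.
  by rewrite le_eqVlt eq_sym; case: eqP => [->|_] /= => [|->]; rewrite ?ltxx ?subrr ?subr0.
- rewrite [LHS]/= -/unit_interval [val _]IH asbool_neg.
  by case: asboolP => _ /=; rewrite ?subrr ?subr0.
- rewrite eval_TOdot IHp IHq; case: asboolP => hp; case: asboolP => hq.
  + by rewrite asboolT //; case: ltP => ?; lra.
  all: by rewrite asboolF => [|[]] //; case: ltP => ?; lra.
Qed.

End LTerm.

(** * The algebra of periodic sequences and its quantifier elimination *)

Section PeriodicSequences.
Variable F : realFieldType.
Local Notation B := (unit_chain F).

Definition periodic (p : nat) (f : nat -> B) :=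
  (0 < p)%N /\ forall n, f (n %% p)%N = f n.

Lemma periodic_dvd p q f : (p %| q)%N -> (0 < q)%N -> periodic p f -> periodic q f.
Proof.
by move=> pq q0 [p0 fp]; split=> // n; rewrite -fp modn_dvdm.
Qed.

Record pseq := PSeq { pseq_fun :> nat -> B; pseq_periodic : exists p, periodic p pseq_fun }.

Lemma pseq_eq (f g : pseq) : (forall n, f n = g n) -> f = g.
Proof.
case: f g => f fp [g gp] /= /funext fg; subst g; congr PSeq; exact: Prop_irrelevance.
Qed.

Lemma pseq_common2 (f g : pseq) : exists2 p, periodic p f & periodic p g.
Proof.
have [[p fp] [q gq]] := (pseq_periodic f, pseq_periodic g).
have pq0 : (0 < p * q)%N by rewrite muln_gt0 (proj1 fp) (proj1 gq).
by exists (p * q)%N; [apply: (periodic_dvd (dvdn_mulr _ (dvdnn p)) pq0 fp)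
                    |apply: (periodic_dvd (dvdn_mull _ (dvdnn q)) pq0 gq)].
Qed.

Fact pseq_oplus_subproof (f g : pseq) : exists p, periodic p (fun n => s_oplus B (f n) (g n)).
Proof.
have [p [p0 fp] [_ gp]] := pseq_common2 f g.
by exists p; split=> // n; rewrite fp gp.
Qed.

Fact pseq_map_subproof (h : B -> B) (f : pseq) : exists p, periodic p (fun n => h (f n)).
Proof. by have [p [p0 fp]] := pseq_periodic f; exists p; split=> // n; rewrite fp. Qed.

Fact pseq_const_subproof (b : B) : exists p, periodic p (fun=> b).
Proof. by exists 1%N. Qed.

Definition pseq_algebra : Structure L0 := {|
  carrier := pseq;
  s_oplus f g := PSeq (pseq_oplus_subproof f g);
  s_neg f := PSeq (pseq_map_subproof (s_neg B) f);
  s_zero := PSeq (pseq_const_subproof (s_zero B));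
  s_delta f := PSeq (pseq_map_subproof (s_delta B) f);
  s_const (c : L0) := match c with end |}.
Local Notation A := pseq_algebra.
Implicit Types (e : nat -> A).

Lemma eval_pseq e t n : (eval A e t : pseq) n = eval B (fun i => (e i : pseq) n) t.
Proof. by elim: t => [i|[]||t IHt s IHs|t IH|t IH] //=; rewrite ?IHt ?IHs ?IH. Qed.

Lemma pseq_MVDelta : is_MVDelta A.
Proof.
move=> t s ts e; apply: pseq_eq => n; rewrite !eval_pseq.
exact/ts/unit_chain_MVDelta.
Qed.

Definition lsat_at e (n : nat) (p : lformula) : Prop :=
  lsat 1 (@positive F) (fun i => val ((e i : pseq) n)) p.

(* The normal form (theta, [psi_1 .. psi_m]) says that theta holds everywhere
   and that each psi_j holds somewhere. *)
Notation nform := (lformula * seq lformula)%type.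

Definition nsat e (x : nform) : Prop :=
  (forall n, lsat_at e n x.1) /\ (forall q, List.In q x.2 -> exists n, lsat_at e n q).

Definition nand (x y : nform) : nform := (LAnd x.1 y.1, x.2 ++ y.2).

(** The flag [b] is the polarity. An equation of sequences is a condition at every index, an
    inequation a condition at some index. *)
Fixpoint dnf (b : bool) (p : formula L0) : seq nform :=
  match p with
  | FEq t s => [:: if b then (ltrans (FEq t s), [::])
                   else (LTrue, [:: LNot (ltrans (FEq t s))])]
  | FNot p => dnf (~~ b) p
  | FAnd p q => if b then [seq nand x y | x <- dnf b p, y <- dnf b q]
                else dnf b p ++ dnf b q
  | FOr p q => if b then dnf b p ++ dnf b q
               else [seq nand x y | x <- dnf b p, y <- dnf b q]
  | FImp p q => if b then dnf (~~ b) p ++ dnf b q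
                else [seq nand x y | x <- dnf (~~ b) p, y <- dnf b q]
  | _ => if b then [::] else [:: (LTrue, [::])]
  end.

Definition nsome e (s : seq nform) := exists2 x, List.In x s & nsat e x.

Lemma nsome_cat e s1 s2 : nsome e (s1 ++ s2) <-> nsome e s1 \/ nsome e s2.
Proof.
split=> [[x /(List.in_app_or s1 s2)[]]|[[x xs]|[x xs]]].
- by left; exists x.
- by right; exists x.
- by exists x => //; apply/List.in_or_app; left.
- by exists x => //; apply/List.in_or_app; right.
Qed.

Lemma nsat_and e x y : nsat e (nand x y) <-> nsat e x /\ nsat e y.
Proof.
split=> [[xy1 xy2]|[[x1 x2] [y1 y2]]].
  by split; split=> [n|q qs]; [have [] := xy1 n | apply: xy2; apply/List.in_or_app; left
    | have [] := xy1 n | apply: xy2; apply/List.in_or_app; right].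
by split=> [n|q /(List.in_app_or x.2 y.2)[/x2|/y2]] //; split; [apply: x1|apply: y1].
Qed.

Lemma nsome_and e s1 s2 :
  nsome e [seq nand x y | x <- s1, y <- s2] <-> nsome e s1 /\ nsome e s2.
Proof.
have nsome_map x s : nsome e (map (nand x) s) <-> nsat e x /\ nsome e s.
  split=> [[z /List.in_map_iff[y [<- ys]] /nsat_and[? ?]]|[sx [y ys sy]]].
    by split=> //; exists y.
  by exists (nand x y); [apply/List.in_map_iff; exists y | apply/nsat_and].
elim: s1 => [|x s1 IH] /=; first by split=> [[]|[[]]].
rewrite nsome_cat nsome_map IH; split=> [[[sx s2e]|[[y ys sy] s2e]]|[[y [<-|ys] sy] s2e]].
- by split=> //; exists x => //; left.
- by split=> //; exists y => //; right.
- by left.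
- by right; split=> //; exists y.
Qed.

Lemma nsome1 e x : nsome e [:: x] <-> nsat e x.
Proof. by split=> [[y [->|[]]]|sx] //; exists x => //; left. Qed.

Lemma lsat_at_eq e n t s :
  lsat_at e n (ltrans (FEq t s)) <-> (eval A e t : pseq) n = (eval A e s : pseq) n.
Proof.
by rewrite !eval_pseq; apply: (lsat_ltrans (positive_cone_field F) (unit_chain_interval F)).
Qed.

Lemma dnfP e p b : qfree p ->
  nsome e (dnf b p) <-> if b then sat A e p else ~ sat A e p.
Proof.
have not_and P Q : ~ (P /\ Q) <-> ~ P \/ ~ Q.
  by case: (pselect P); case: (pselect Q); tauto.
elim: p b => [|t s|p IH|p IHp q IHq|p IHp q IHq|p IHp q IHq|//|//] b.
- case: b => _ /=; first by split=> [[]|[]].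
  by rewrite nsome1; split=> [_ []|_]; split.
- case: b => _ /=; rewrite nsome1 /nsat /=.
    split=> [[ts _]|ts]; first by apply: pseq_eq => n; apply/lsat_at_eq.
    by split=> // n; apply/lsat_at_eq; rewrite ts.
  split=> [[_ /(_ _ (or_introl erefl))[n /= nts] ts]|nts].
    by apply: nts; apply/lsat_at_eq; rewrite ts.
  split=> [//|_ [<-|//]]; apply: contrapT => H; apply: nts; apply: pseq_eq => n.
  by apply/lsat_at_eq; apply: contrapT => nts; apply: H; exists n.
- by move=> qp /=; rewrite IH //; case: b => //=; split=> [? ?|/contrapT]; auto.
- case=> qp qq; case: b => /=; first by rewrite nsome_and IHp // IHq.
  by rewrite nsome_cat IHp // IHq // not_and.
- case=> qp qq; case: b => /=; first by rewrite nsome_cat IHp // IHq.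
  by rewrite nsome_and IHp // IHq //; tauto.
- case=> qp qq; case: b => /=; first rewrite nsome_cat IHp // IHq //.
    by case: (pselect (sat A e p)); tauto.
  by rewrite nsome_and IHp // IHq //; case: (pselect (sat A e p)); tauto.
Qed.

(** Each existential requirement carries theta along, since one value at its index has to satisfy
    both. *)
Definition nelim (x : nform) : nform :=
  (elim_var x.1, [seq elim_var (LAnd x.1 q) | q <- x.2]).

Lemma lsat_at_scons e f n p : lsat_at (scons (f : A) e) n p =
  lsat 1 (@positive F) (scons (val ((f : pseq) n)) (fun i => val ((e i : pseq) n))) p.
Proof. by rewrite /lsat_at; congr lsat; apply: funext => -[]. Qed.

Lemma nelim_intro e f x : nsat (scons f e) x -> nsat e (nelim x).
Proof.
have cone := positive_cone_field F.
have intro n p : lsat_at (scons f e) n p -> lsat_at e n (elim_var p).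
  rewrite lsat_at_scons; apply: elim_var_intro => //.
    exact: (mvi_ge0 (unit_chain_interval F)).
  exact: (mvi_le1 (unit_chain_interval F)).
case=> x1 x2; split=> [n|_ /List.in_map_iff[q [<- qx]]]; first exact: intro.
by have [n qn] := x2 q qx; exists n; apply: intro; exact: (conj (x1 n) qn).
Qed.

(* With a common period [p] of the parameters, the witness has period
   [(m + 1) * p]: in block [j] it satisfies the [j]-th existential requirement. *)
Lemma nelim_sound e p x : (forall i, periodic p (e i : pseq)) ->
  nsat e (nelim x) -> exists f, nsat (scons f e) x.
Proof.
move=> ep; have p0 : (0 < p)%N := proj1 (ep 0%N).
case: x => th qs [/= th_e qs_e]; set m := size qs.
pose env n := fun i => val ((e i : pseq) n) : F.
have envp n : env (n %% p)%N = env n by apply: funext => i; rewrite /env (proj2 (ep i)).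
have pick n q : lsat_at e n (elim_var q) ->
    exists b : B, lsat 1 (@positive F) (scons (val b) (env n)) q.
  by move=> /elim_var_sound[b b01 bq]; exists (@exist F (fun t => 0 <= t <= 1) _ b01).
have [w wP] := choice (fun n => pick n th (th_e n)).
(* For requirement [j], a residue modulo [p] where it can be met and a value meeting it together
   with [th]. *)
pose good j (sv : nat * B) := (j < m)%N -> (sv.1 < p)%N /\
  lsat 1 (@positive F) (scons (val sv.2) (env sv.1)) (LAnd th (List.nth j qs LTrue)).
have [|sv svP] := choice (P := good).
  move=> j; case: (ltnP j m) => jm; last first.
    by exists (0%N, s_zero B); rewrite /good ltnNge jm.
  have [|n /pick[b bq]] := qs_e (elim_var (LAnd th (List.nth j qs LTrue))).
    apply/List.in_map_iff; exists (List.nth j qs LTrue); split=> //.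
    by apply: List.nth_In; apply/ssrnat.ltP.
  by exists ((n %% p)%N, b) => _; split; rewrite /= ?ltn_pmod // envp.
(* Block [j] deviates from the generic witness [w] only at the residue chosen for requirement [j].
   The extra block keeps the period positive when there are no requirements. *)
pose fn n := let r := (n %% (m.+1 * p))%N in
  if (r %/ p < m)%N && (r %% p == (sv (r %/ p)%N).1)%N then (sv (r %/ p)%N).2 else w (n %% p)%N.
have mp0 : (0 < m.+1 * p)%N by rewrite muln_gt0.
have fper : exists q, periodic q fn.
  exists (m.+1 * p)%N; split=> // n; rewrite /fn modn_mod.
  by rewrite [X in w X]modn_dvdm // dvdn_mull.
exists (PSeq fper); have fP n : lsat_at (scons (PSeq fper : A) e) n th.
  rewrite lsat_at_scons -/(env n) /= /fn; case: ifP => [/andP[jm /eqP rs]|_].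
    have [_ [H _]] := svP _ jm; move: H; rewrite -rs -(envp n).
    by rewrite modn_dvdm // dvdn_mull.
  by rewrite -(envp n); apply: wP.
split=> // q /= /(List.In_nth _ _ LTrue)[j [/ssrnat.ltP jm jq]].
have {}jm : (j < m)%N by [].
have [sp [_ svq]] := svP j jm.
exists (j * p + (sv j).1)%N; rewrite lsat_at_scons -/(env _) /= /fn.
have lt1 : (j * p + (sv j).1 < m.+1 * p)%N.
  by rewrite mulSn addnC -addSn leq_add // leq_mul2r ltnW ?orbT.
rewrite modn_small // divnMDl // divn_small // addn0 jm modnMDl modn_small // eqxx /=.
by move: svq; rewrite jq -(envp (_ + _)%N) modnMDl modn_small.
Qed.

(** An [lterm] is 0 or 1 at each index: equal to [TOne] means true everywhere, different from
    [TZero] means true somewhere. *)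
Definition nformula (x : nform) : formula L0 :=
  foldr (fun q r => FAnd (FNot (FEq (lterm q) TZero)) r) (FEq (lterm x.1) TOne) x.2.

Lemma qfree_nformula x : qfree (nformula x).
Proof. by case: x => th qs; rewrite /nformula; elim: qs. Qed.

Lemma sat_nformula e x : sat A e (nformula x) <-> nsat e x.
Proof.
have at1 q n : (eval A e (lterm q) : pseq) n = s_neg B (s_zero B) <-> lsat_at e n q.
  rewrite eval_pseq; split=> [/(congr1 val)|qn].
    rewrite eval_lterm /= subr0; case: asboolP => // _ /esym/eqP.
    by rewrite oner_eq0.
  by apply: val_inj; rewrite eval_lterm asboolT //= subr0.
have at0 q n : (eval A e (lterm q) : pseq) n = s_zero B <-> ~ lsat_at e n q.
  rewrite eval_pseq; split=> [/(congr1 val)|qn].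
    rewrite eval_lterm /=; case: asboolP => // _ /eqP.
    by rewrite oner_eq0.
  by apply: val_inj; rewrite eval_lterm asboolF.
case: x => th qs; rewrite /nformula /nsat /=; elim: qs => [|q qs IH] /=.
  split=> [H|[H _]]; last by apply: pseq_eq => n; apply/at1.
  by split=> // n; apply/at1; rewrite H.
rewrite IH; split=> [[nq [H1 H2]]|[H1 H2]].
  split=> // _ [<-|/H2//]; apply: contrapT => H; apply: nq; apply: pseq_eq => n.
  by apply/at0 => qn; apply: H; exists n.
split; last by split=> // r rq; apply: H2; right.
have [n qn] := H2 q (or_introl erefl).
by move=> E; have /at0 : (eval A e (lterm q) : pseq) n = s_zero B by rewrite E.
Qed.

Lemma nsome_formula (s : seq nform) : exists2 p, qfree p &
  forall e, sat A e p <-> nsome e s.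
Proof.
elim: s => [|x s [p qp ps]]; first by exists FFalse => // e; split=> [|[]].
exists (FOr (nformula x) p); first by split=> //; apply: qfree_nformula.
move=> e; rewrite -cat1s nsome_cat nsome1 -ps /= sat_nformula //.
Qed.

Lemma common_period e k : (forall i, (k <= i)%N -> e i = s_zero A) ->
  exists p, forall i, periodic p (e i : pseq).
Proof.
move=> e0; have [p p0 ep] : exists2 p, (0 < p)%N & forall i, (i < k)%N -> periodic p (e i : pseq).
  elim: k {e0} => [|k [p p0 ep]]; first by exists 1%N.
  have [q kq] := pseq_periodic (e k).
  have pq0 : (0 < p * q)%N by rewrite muln_gt0 p0 (proj1 kq).
  exists (p * q)%N => // i; rewrite ltnS leq_eqVlt => /orP[/eqP->|/ep ip].
    by apply: (periodic_dvd _ _ kq); rewrite ?dvdn_mull.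
  by apply: (periodic_dvd _ _ ip); rewrite ?dvdn_mulr.
exists p => i; case: (ltnP i k) => [/ep//|/e0 ->].
by split.
Qed.

Lemma pseq_qe p : exists2 q, qfree q & forall e, sat A e p <-> sat A e q.
Proof.
have qe_ex r b : qfree r -> exists2 q, qfree q &
    forall e, (exists f, if b then sat A (scons f e) r else ~ sat A (scons f e) r) <-> sat A e q.
  move=> qr; have [q qq qE] := nsome_formula (map nelim (dnf b r)).
  exists q => // e; have [k kr] := closed_exists r; have [l lq] := closed_exists q.
  (* Infinitely many parameters might have no common period; zeroing the irrelevant ones provides
     it. *)
  pose e0 i := if (i < k + l)%N then e i else s_zero A.
  have ext f : sat A (scons f e) r <-> sat A (scons f e0) r.
    by apply: (sat_ext kr) => -[|i] //= ik; rewrite /e0 (ltn_trans (ltnSn i)) // (leq_trans ik) ?leq_addr.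
  have -> : sat A e q <-> sat A e0 q.
    by apply: (sat_ext lq) => i il; rewrite /e0 (leq_trans il) ?leq_addl.
  have [d ed] : exists d, forall i, periodic d (e0 i : pseq).
    by apply: (@common_period _ (k + l)) => i ki; rewrite /e0 ltnNge ki.
  rewrite qE; split=> [[f H]|[_ /List.in_map_iff[x [<- xr]] /(nelim_sound ed)[f fx]]].
    have /(dnfP _ b qr)[x xr fx] : if b then sat A (scons f e0) r else ~ sat A (scons f e0) r.
      by move: H; case: (b); rewrite ext.
    by exists (nelim x); [apply/List.in_map_iff; exists x | apply: nelim_intro fx].
  exists f; have := proj1 (dnfP (scons f e0) b qr) (ex_intro2 _ _ x xr fx).
  by case: (b); rewrite ext.
elim: p => [|t s|p [p' qp pE]|p [p' qp pE] q [q' qq qE]|p [p' qp pE] q [q' qq qE]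
           |p [p' qp pE] q [q' qq qE]|p [p' qp pE]|p [p' qp pE]].
- by exists FFalse.
- by exists (FEq t s).
- by exists (FNot p') => // e /=; rewrite pE.
- by exists (FAnd p' q') => // e /=; rewrite pE qE.
- by exists (FOr p' q') => // e /=; rewrite pE qE.
- by exists (FImp p' q') => // e /=; rewrite pE qE.
- have [q qq qE] := qe_ex p' false qp; exists (FNot q) => // e /=; rewrite -qE.
  split=> [H [f nf]|H f]; first by apply: nf; apply/pE.
  by apply: contrapT => nf; apply: H; exists f; rewrite -pE.
- have [q qq qE] := qe_ex p' true qp; exists q => // e /=; rewrite -qE.
  by split=> -[f /pE]; exists f.
Qed.

End PeriodicSequences.

Local Close Scope ring_scope.

(** * The model completion *)

Definition teq (t s : term L0) : term L0 :=
  TDelta (TOdot (TOplus (TNeg t) s) (TOplus (TNeg s) t)).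

Definition teqs (E : seq (term L0 * term L0)) : term L0 :=
  foldr (fun ts r => TOdot (teq ts.1 ts.2) r) TOne E.

Definition holds (M : Structure L0) e (ts : term L0 * term L0) :=
  eval M e ts.1 = eval M e ts.2.

Section ChainTerms.
Variables (C : Structure L0) (hC : is_MVDelta_chain C).
Let mv : is_MV C := proj1 hC.
Let deltaC := proj2 (proj2 hC).
Implicit Types (e : nat -> C).

Lemma mv_odot1x (x : C) : mv_odot (mv_one C) x = x.
Proof. by rewrite /mv_odot mvN1 // mv0x // mvNN. Qed.

Lemma mv_odot0x (x : C) : mv_odot (s_zero C) x = s_zero C.
Proof. by rewrite /mv_odot -/(mv_one C) mv1x // mvN1. Qed.

(** The biconditional under Delta is one exactly when the two values are equal, by antisymmetry of
    the order; Delta sends all its other values to zero. *)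
Lemma eval_teq e t s :
  eval C e (teq t s) = if `[< holds e (t, s) >] then mv_one C else s_zero C.
Proof.
have -> : eval C e (teq t s) = s_delta C (mv_odot
   (s_oplus C (s_neg C (eval C e t)) (eval C e s))
   (s_oplus C (s_neg C (eval C e s)) (eval C e t))) by [].
case: asboolP => [->|ts] /=.
  by rewrite mvNx // mv_odot1x; apply: (proj1 (deltaC _)).
apply: (proj2 (deltaC _)) => H; apply: ts; rewrite /holds /=.
have ts1 := mv_odot_eq1 mv H; move: H; rewrite mv_odotC // => /(mv_odot_eq1 mv) st1.
by have := mvL mv (eval C e t) (eval C e s); rewrite ts1 st1 mvN1 // !mv0x.
Qed.

Lemma eval_teqs e E : eval C e (teqs E) =
  if `[< forall ts, List.In ts E -> holds e ts >] then mv_one C else s_zero C.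
Proof.
elim: E => [|[t s] E IH]; first by rewrite asboolT.
have -> : eval C e (teqs ((t, s) :: E)) = mv_odot (eval C e (teq t s)) (eval C e (teqs E)) by [].
rewrite eval_teq IH; case: asboolP => ts; last first.
  by rewrite mv_odot0x asboolF // => H; apply: ts; apply: H; left.
rewrite mv_odot1x; congr (if _ then _ else _); apply: asbool_equiv_eq.
by split=> [H ts' [<-|/H]|H ts' ?] //; apply: H; right.
Qed.

End ChainTerms.

(** [M] may fail to be a chain, so only identities of chains are available; [teq] of a variable with
    itself being one is such an identity. *)
Lemma eval_teqs_true (M : Structure L0) (e : nat -> M) E : is_MVDelta M ->
  (forall ts, List.In ts E -> holds e ts) -> eval M e (teqs E) = eval M e TOne.
Proof.
move=> hM; elim: E => // -[t s] E IH H.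
have teq1 : eval M (fun=> eval M e s) (teq (TVar 0) (TVar 0)) = eval M e TOne.
  apply: (hM _ TOne) => B hB e'; rewrite eval_teq // asboolT //.
have odot11 : eval M e (TOdot TOne TOne) = eval M e TOne.
  by apply: hM => B hB e'; apply: (mv_odot1x hB).
rewrite -odot11 [LHS]/= IH => [|ts ?]; last by apply: H; right.
have := H (t, s) (or_introl erefl); rewrite /holds /= => ->.
by move: teq1 => /= ->.
Qed.

Section FiniteTransfer.
Variables (F : realFieldType) (M : Structure L0) (hM : is_MVDelta M) (e : nat -> M).
Variable E : seq (term L0 * term L0).
Hypothesis eE : forall ts, List.In ts E -> holds e ts.

Definition FHolds : formula L0 := foldr (fun ts p => FAnd (FEq ts.1 ts.2) p) (FEq TZero TZero) E.

Lemma sat_FHolds (N : Structure L0) (e' : nat -> N) :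
  sat N e' FHolds <-> forall ts, List.In ts E -> holds e' ts.
Proof.
rewrite /FHolds; elim: E => //= -[t s] E' IH; rewrite IH.
by split=> [[ts H] ts' [<-|/H]|H] //; split=> [|ts' ?]; apply: H; [left|right].
Qed.

Lemma qfree_FHolds : qfree FHolds.
Proof. by rewrite /FHolds; elim: E. Qed.

(** Otherwise [E] would imply t = s in every chain, by transfer. Multiplying both sides by [teqs E]
    turns this implication into an identity of chains, hence of [M], where [teqs E] is one. *)
Lemma chain_identity ts : ~ holds e ts -> exists e' : nat -> unit_chain F,
  (forall ts', List.In ts' E -> holds e' ts') /\ ~ holds e' ts.
Proof.
case: ts => t s nts; apply: contrapT => H; apply: nts.
have id : eval M e (TOdot (teqs E) t) = eval M e (TOdot (teqs E) s).
  apply: hM => B hB eB.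
  have -> : eval B eB (TOdot (teqs E) t) = mv_odot (eval B eB (teqs E)) (eval B eB t) by [].
  have -> : eval B eB (TOdot (teqs E) s) = mv_odot (eval B eB (teqs E)) (eval B eB s) by [].
  rewrite eval_teqs //; case: asboolP => EB; last by rewrite !mv_odot0x.
  rewrite !mv_odot1x //; apply: contrapT => tsB.
  (* Transfer requires a nontrivial chain; a trivial one satisfies every equation. *)
  have [triv|nt] := pselect (s_zero B = mv_one B).
    have all0 (x : B) : x = s_zero B.
      by rewrite -(mvx0 (proj1 hB) x) [in LHS]triv (mvx1 (proj1 hB)) -triv.
    by apply: tsB; rewrite (all0 (eval B eB t)) (all0 (eval B eB s)).
  have [||e' [/sat_FHolds Ee' nts]] := @chain_sat_transfer F B
      (FAnd FHolds (FNot (FEq t s))) eB hB nt.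
  - by split=> //; apply: qfree_FHolds.
  - by split=> //; apply/sat_FHolds.
  by apply: H; exists e'.
have odot1 r : eval M e (TOdot (teqs E) r) = eval M e r.
  transitivity (eval M e (TOdot TOne r)); first by rewrite /= (eval_teqs_true hM eE).
  by apply: hM => B hB e'; apply: (mv_odot1x hB).
by move: id; rewrite !odot1.
Qed.

(** Each inequation gets its own assignment in the unit chain, and these assignments become the
    successive entries of periodic sequences. *)
Lemma finite_transfer (D : seq (term L0 * term L0)) : s_zero M <> s_neg M (s_zero M) ->
    (forall ts, List.In ts D -> ~ holds e ts) ->
  exists e' : nat -> pseq_algebra F, (forall ts, List.In ts E -> holds e' ts) /\
    (forall ts, List.In ts D -> ~ holds e' ts).
Proof.
(* The extra inequation, true in [M], makes the period [size D'] positive. *)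
move=> nt neqD; pose D' := (TZero, TOne) :: D.
have [|w wP] := @choice nat (nat -> unit_chain F) (fun j w => j < size D' ->
    (forall ts, List.In ts E -> holds w ts) /\ ~ holds w (List.nth j D' (TZero, TOne))).
  move=> j; case: (ltnP j (size D')) => jD; last by exists (fun=> s_zero _).
  have [|w ?] := @chain_identity (List.nth j D' (TZero, TOne)); last by exists w.
  have : List.In (List.nth j D' (TZero, TOne)) D' by apply: List.nth_In; apply/ssrnat.ltP.
  by case=> [<-|/neqD].
have per i : exists p, periodic p (fun n => w (n %% size D') i).
  by exists (size D'); split=> // n; rewrite modn_mod.
pose e' i : pseq_algebra F := PSeq (per i); exists e'.
have e'E n : (fun i => (e' i : pseq F) n) = w (n %% size D') by [].
split=> ts inE.
  apply: pseq_eq => n; rewrite !eval_pseq e'E.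
  by have [|H _] := wP (n %% size D'); [rewrite ltn_mod | apply: H].
have [j [/ssrnat.ltP jD jts]] := List.In_nth _ _ (TZero, TOne) (or_intror inE : List.In ts D').
have {}jD : j < size D' by [].
move=> /(congr1 (fun f : pseq F => f j)); rewrite !eval_pseq e'E modn_small //.
by have [_] := wP j jD; rewrite jts.
Qed.

End FiniteTransfer.

Definition with_consts (D : Type) (A : Structure L0) (h : D -> A) : Structure D := {|
  carrier := A; s_oplus := s_oplus A; s_neg := s_neg A; s_zero := s_zero A;
  s_delta := s_delta A; s_const := h |}.

Lemma sat_with_consts D (A : Structure L0) (h : D -> A) e p :
  sat (with_consts h) e (lift p) <-> sat A e p.
Proof.
rewrite sat_lift; case: A h e => A o n z d s h e.
by suff <- : (fun c : L0 => match c return A with end) = s; last by apply: funext => -[].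
Qed.

Lemma partial_embedding (F : realFieldType) (M : Structure L0) (s : seq M) :
    is_MVDelta M -> s_zero M <> s_neg M (s_zero M) ->
  exists h : M -> pseq_algebra F, [/\ h (s_zero M) = s_zero (pseq_algebra F),
    forall a, List.In a s -> h (s_neg M a) = s_neg (pseq_algebra F) (h a),
    forall a, List.In a s -> h (s_delta M a) = s_delta (pseq_algebra F) (h a),
    forall a b, List.In a s -> List.In b s ->
      h (s_oplus M a b) = s_oplus (pseq_algebra F) (h a) (h b) &
    forall a b, List.In a s -> List.In b s -> h a = h b -> a = b].
Proof.
move=> hM nt; set ss := List.list_prod s s.
(* Results of operations on [s] are named as well, so the operation tables on [s] become finitely
   many equations between variables. *)
have [g [v gv]] := indexing_exists (s_zero M) (s_zero M :: s ++ map (s_neg M) s ++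
  map (s_delta M) s ++ map (fun ab => s_oplus M ab.1 ab.2) ss).
pose x a : term L0 := TVar (g a).
have v0 : v (g (s_zero M)) = s_zero M by apply: gv; left.
have vs a : List.In a s -> v (g a) = a.
  by move=> ?; apply: gv; right; apply/List.in_or_app; left.
have vN a : List.In a s -> v (g (s_neg M a)) = s_neg M a.
  move=> ?; apply: gv; right; apply/List.in_or_app; right; apply/List.in_or_app; left.
  exact: List.in_map.
have vd a : List.In a s -> v (g (s_delta M a)) = s_delta M a.
  move=> ?; apply: gv; right; do 2![apply/List.in_or_app; right].
  by apply/List.in_or_app; left; apply: List.in_map.
have vD a b : List.In a s -> List.In b s -> v (g (s_oplus M a b)) = s_oplus M a b.
  move=> ? ?; apply: gv; right; do 3![apply/List.in_or_app; right].
  by apply/List.in_map_iff; exists (a, b); split=> //; apply/List.in_prod.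
pose E : seq (term L0 * term L0) := (x (s_zero M), TZero) ::
  map (fun a => (x (s_neg M a), TNeg (x a))) s ++
  map (fun a => (x (s_delta M a), TDelta (x a))) s ++
  map (fun ab => (x (s_oplus M ab.1 ab.2), TOplus (x ab.1) (x ab.2))) ss.
pose D := map (fun ab => (x ab.1, x ab.2)) (List.filter (fun ab => `[< ab.1 <> ab.2 >]) ss).
have inss a b : List.In (a, b) ss <-> List.In a s /\ List.In b s by apply: List.in_prod_iff.
have [||h [hE hD]] := @finite_transfer F M hM v E _ D nt.
- move=> ts; case=> [<- //|]; case/List.in_app_iff; last case/List.in_app_iff.
  + by case/List.in_map_iff => a [<- ?]; rewrite /holds /= vN ?vs.
  + by case/List.in_map_iff => a [<- ?]; rewrite /holds /= vd ?vs.
  + by case/List.in_map_iff => -[a b] [<- /inss[? ?]]; rewrite /holds /= vD ?vs.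
- move=> ts /List.in_map_iff[[a b] [<- /List.filter_In[/inss[? ?] /asboolP ab]]].
  by rewrite /holds /= !vs.
exists (fun a => h (g a)); split.
- by apply: (hE (x (s_zero M), TZero)); left.
- move=> a ?; apply: (hE (x (s_neg M a), TNeg (x a))); right; apply/List.in_or_app; left.
  by apply/List.in_map_iff; exists a.
- move=> a ?; apply: (hE (x (s_delta M a), TDelta (x a))).
  right; apply/List.in_or_app; right.
  by apply/List.in_or_app; left; apply/List.in_map_iff; exists a.
- move=> a b ? ?; apply: (hE (x (s_oplus M a b), TOplus (x a) (x b))).
  right; do 2![apply/List.in_or_app; right].
  by apply/List.in_map_iff; exists (a, b); split=> //; apply/inss.
- move=> a b ? ? hab; apply: contrapT => ab; apply: (hD (x a, x b)) => //.
  apply/List.in_map_iff; exists (a, b); split=> //; apply/List.filter_In.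
  by split; [apply/inss | apply/asboolP].
Qed.

(** * Models of the diagram as embeddings *)

Section Diagram.
Variables (M : Structure L0) (N : Structure M).

Lemma eval_expand e e' t : embedding M (reduct N) (s_const N) -> term_closed_at 0 t ->
  eval N e t = s_const N (eval (expand M) e' t).
Proof.
case=> _ [fD [fN [f0 fd]]].
elim: t => //= [k /ssrnat.ltP //|t IHt s IHs [ct cs]|t IH ct|t IH ct].
- by rewrite IHt // IHs.
- by rewrite IH.
- by rewrite IH.
Qed.

Lemma model_diagram : is_model (diagram M) N <-> embedding M (reduct N) (s_const N).
Proof.
split=> [hN|emb p [sp [lp pM]] e].
  have inD p : sentence p -> literal p -> sat (expand M) (fun=> s_zero M) p ->
      sat N (fun=> s_zero N) p.
    move=> sp lp pM; apply: hN; split=> //; split=> // e.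
    by apply/(@sat_ext _ (expand M) e (fun=> s_zero M) 0 p sp) => //.
  split=> [a b ab|].
    apply: contrapT => nab.
    by apply: (inD (FNot (FEq (TCst a) (TCst b)))).
  split=> [a b|].
    by apply: (inD (FEq (TCst (s_oplus M a b)) (TOplus (TCst a) (TCst b)))).
  split=> [a|]; first by apply: (inD (FEq (TCst (s_neg M a)) (TNeg (TCst a)))).
  split=> [|a]; first by apply: (inD (FEq (TCst (s_zero M)) TZero)).
  by apply: (inD (FEq (TCst (s_delta M a)) (TDelta (TCst a)))).
have {}pM := pM (fun=> s_zero M).
case: p sp lp pM => //= [t s [ct cs] _ ts|[]//= t s [ct cs] _ nts ts].
  by rewrite !(eval_expand e (fun=> s_zero M) emb) // ts.
apply: nts; apply: (proj1 emb).
by rewrite -!(eval_expand e (fun=> s_zero M) emb).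
Qed.

End Diagram.

Definition trivial_algebra : Structure L0 := {|
  carrier := unit; s_oplus _ _ := tt; s_neg _ := tt; s_zero := tt; s_delta _ := tt;
  s_const (c : L0) := match c with end |}.

Lemma trivial_env (e e' : nat -> trivial_algebra) : e = e'.
Proof. by apply: funext => n; case: (e n) (e' n) => -[]. Qed.

(** * The completing theory: quantifier elimination, universal consequences, completeness over
    diagrams *)

Section Completion.
Variable F : realFieldType.
Local Notation A := (pseq_algebra F).

(* The one-element algebra embeds in no nontrivial one, hence is its own
   existentially closed extension and must be a model of the completion. *)
Definition MVDelta_completion : theory L0 := fun p =>
  [/\ sentence p, forall e, sat A e p & forall e, sat trivial_algebra e p].
Local Notation Ts := MVDelta_completion.

Lemma completion_qe p : exists2 q, qfree q & forall M : Structure L0, is_model Ts M ->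
  forall e : nat -> M, sat M e p <-> sat M e q.
Proof.
have [q0 qq0 q0E] := pseq_qe F p.
(* In the one-element algebra [p] has a fixed truth value, recorded by [c]; the equation 0 = 1
   separates this case from that of periodic sequences. *)
pose c : formula L0 :=
  if `[< sat trivial_algebra (fun=> tt) p >] then FNot FFalse else FFalse.
pose triv : formula L0 := FEq TZero (TNeg TZero).
pose q := FOr (FAnd triv c) (FAnd (FNot triv) q0).
have qq : qfree q by rewrite /q /c; case: asboolP.
pose pq := FAnd (FImp p q) (FImp q p).
have pqE (M : Structure L0) (e : nat -> M) : sat M e pq <-> (sat M e p <-> sat M e q) by [].
have [n npq] := closed_exists pq.
exists q => // M hM e; apply/pqE.
suff Tpq : Ts (generalize n pq).
  by have /(sat_generalize e npq) := hM _ Tpq e; apply.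
split; first exact: sentence_generalize.
- move=> e'; apply/(sat_generalize _ npq) => e''; apply/pqE; rewrite q0E /q /=.
  have nt : ~ s_zero A = s_neg A (s_zero A).
    move=> /(congr1 (fun f : pseq F => \val (f 0))) /= /esym/eqP.
    by rewrite GRing.subr0 GRing.oner_eq0.
  by tauto.
- move=> e'; apply/(sat_generalize _ npq) => e''; apply/pqE; rewrite /q /= /c.
  by rewrite (trivial_env e'' (fun=> tt)); case: asboolP => /=; tauto.
Qed.

Lemma is_model_MVDelta M : is_model Th_MVDelta M -> is_MVDelta M.
Proof.
move=> hM t s ts e; have [n nts] := closed_exists (FEq t s).
suff Tts : Th_MVDelta (generalize n (FEq t s)).
  by have /(sat_generalize _ nts)/(_ e) := hM _ Tts e.
split=> [|B hB e']; first exact: sentence_generalize.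
by apply/(sat_generalize _ nts) => e''; apply: hB.
Qed.

Lemma completion_model_MVDelta M : is_model Ts M -> is_model Th_MVDelta M.
Proof.
move=> hM p [sp pM]; apply: hM; split=> // e; apply: pM; first exact: pseq_MVDelta.
by move=> t s _ e'; case: (eval _ e' t) (eval _ e' s) => -[].
Qed.

Lemma reduct_model (M : Structure L0) (N : Structure M) :
  is_model (with_diagram Ts M) N -> is_model Ts (reduct N).
Proof. by move=> hN p Tp e; apply/sat_lift; apply: hN; left; exists p. Qed.

Lemma diagram_embedding (M : Structure L0) (N : Structure M) :
  is_model (with_diagram Ts M) N -> embedding M (reduct N) (s_const N).
Proof. by move=> hN; apply/model_diagram => p Dp; apply: hN; right. Qed.

(** For nontrivial [M], the partial embeddings on finite lists are combined in an ultrapower: any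
    given elements lie in almost every list, so each embedding condition holds almost everywhere. *)
Lemma with_diagram_model (M : Structure L0) : is_MVDelta M ->
  exists N : Structure M, is_model (with_diagram Ts M) N.
Proof.
move=> hM; have [triv|nt] := pselect (s_zero M = s_neg M (s_zero M)).
  have all0 (x : M) : x = s_zero M.
    transitivity (s_oplus M x (s_zero M)).
      apply/esym/(hM (TOplus (TVar 0) TZero) (TVar 0) _ (fun=> x)) => B hB e.
      exact: (mvx0 (proj1 hB)).
    rewrite {1}triv [RHS]triv.
    apply: (hM (TOplus (TVar 0) TOne) TOne _ (fun=> x)) => B hB e.
    exact: (mvx1 (proj1 hB)).
  exists (with_consts (fun _ : M => (tt : trivial_algebra))) => p [[q [Tq ->]]|Dp] e.
    by apply/sat_with_consts; case: Tq.
  move: p Dp e; apply: (proj2 (model_diagram _)); split=> // x y _.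
  by rewrite (all0 x) (all0 y).
have [h hP] := choice (fun s => partial_embedding F s hM nt).
have [U [UU Uin]] := cone_ultrafilter M.
pose S s := with_consts (h s).
exists (ultraproduct U S) => p [[q [Tq ->]]|Dp] e.
  have -> : e = fun n => upi U (urepr (e n)) by apply: funext => n; rewrite upiK.
  apply/los; apply: filterS filterT => s _; apply/sat_with_consts.
  by case: Tq.
move: p Dp e; apply: (proj2 (model_diagram _)); split=> [a b|].
  move=> /upiP ab; have [s [[/= sab sa] sb]] := filter_ex (filterI (filterI ab (Uin a)) (Uin b)).
  by have [_ _ _ _] := hP s; apply.
split=> [a b|].
  apply: etrans (esym (upi_oplus _ _ _)); apply/upiP.
  by apply: filterS (filterI (Uin a) (Uin b)) => s [sa sb]; have [_ _ _ H _] := hP s; apply: H.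
split=> [a|].
  apply: etrans (esym (upi_neg _ _)); apply/upiP.
  by apply: filterS (Uin a) => s sa; have [_ H _ _ _] := hP s; apply: H.
split=> [|a].
  by apply/upiP; apply: filterS filterT => s _; have [H _ _ _ _] := hP s; apply: H.
apply: etrans (esym (upi_delta _ _)); apply/upiP.
by apply: filterS (Uin a) => s sa; have [_ _ H _ _] := hP s; apply: H.
Qed.

Lemma completion_model_complete : model_complete Ts.
Proof.
move=> M N f hM hN emb p e; have [q qq qE] := completion_qe p.
by rewrite (qE _ hM) (qE _ hN) (sat_embedding _ emb).
Qed.

(** Models of the completion are models of the original theory; conversely each model of the latter
    embeds in one of the former, and universal formulas pass to subalgebras. *)
Lemma completion_universal p : universal p ->
  entails Th_MVDelta p <-> entails Ts p.
Proof.
move=> up; split=> [H M hM e|H M hM e]; first exact/H/completion_model_MVDelta.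
have [N hN] := with_diagram_model (is_model_MVDelta hM).
apply: (universal_embedding (diagram_embedding hN) up).
by apply: H; apply: reduct_model.
Qed.

(** With constants read as parameters from [M], the sentence becomes quantifier-free, and its truth
    in any model of the diagram is already decided in [M]. *)
Lemma with_diagram_complete (M : Structure L0) : is_model Th_MVDelta M ->
  complete (with_diagram Ts M).
Proof.
move=> hM; split; first exact/with_diagram_model/is_model_MVDelta.
move=> p sp; have [g [h gh]] := indexing_exists (s_zero M) (consts p).
have [q qq qE] := completion_qe (vars_of_consts g 0 p).
have pq (N : Structure M) (hN : is_model (with_diagram Ts M) N) e :
    sat N e p <-> sat M h q.
  rewrite -(sat_embedding h (diagram_embedding hN) qq) -(qE _ (reduct_model hN)).
  exact: (sat_vars_of_consts sp gh).
have [qM|nqM] := pselect (sat M h q); [left|right] => N hN e /=.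
  exact/(pq N hN e).
by move/(pq N hN e).
Qed.

End Completion.

Theorem theorem7p8 : has_model_completion Th_MVDelta.
Proof.
exists (MVDelta_completion rat); split; first by move=> p [].
split; first exact: completion_model_complete.
split=> [p _ up|M hM]; first exact: completion_universal.
exact: with_diagram_complete.
Qed.
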